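(* Let $(N,g)$ be a Riemannian manifold, let $V\colon N\to\mathbb{R}$ be smooth, and let $\phi\colon\mathbb{R}^n\to N$ be a smooth harmonic map with potential, i.e. $\tau(\phi)=-\nabla V(\phi)$. Let $B_r(x)$ be the ball with radius $r>0$ around $x\in\mathbb{R}^n$. Then $$\frac{d}{dr}\Big(r^{2-n}\int_{B_r(x)}\big(\tfrac12|d\phi|^2-V(\phi)\big)dx\Big)=r^{2-n}\int_{\partial B_r(x)}\Big|\frac{\partial\phi}{\partial r}\Big|^2d\sigma-2r^{1-n}\int_{B_r(x)}V(\phi)\,dx.$$
   Context: $\mathbb{R}^n$ carries the Euclidean metric. The tension field $\tau(\phi)\in\Gamma(\phi^*TN)$ is the trace of the second fundamental form $\nabla d\phi$; $\nabla V$ is the gradient of $V$ on $(N,g)$. $\frac{\partial\phi}{\partial r}=d\phi(\partial_r)$ is the derivative of $\phi$ in the unit radial direction from the center $x$, and $d\sigma$ is the surface measure on $\partial B_r(x)$. *)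

(* Defs.v *)
From HB Require Import structures.
From mathcomp Require Import all_boot all_order all_algebra.
From mathcomp Require Import all_classical all_reals all_analysis.

Set Implicit Arguments.
Unset Strict Implicit.
Unset Printing Implicit Defensive.
Import Order.TTheory GRing.Theory Num.Theory.
Import numFieldNormedType.Exports.

Local Open Scope classical_set_scope.
Local Open Scope ring_scope.

(* The library puts the sup norm on ['rV[R]_n]: its topology and its notion of
   differentiability are the Euclidean ones, but lengths and balls are not. *)
Section Euclidean.
Context {R : realType} {n : nat}.
Implicit Types x y : 'rV[R]_n.

Definition enorm x : R := Num.sqrt (\sum_(i < n) x 0 i ^+ 2).

Definition eball x (r : R) : set 'rV[R]_n := [set y | enorm (y - x) < r].

Definition ebasis (i : 'I_n) : 'rV[R]_n := delta_mx 0 i.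

(* [radial x y] is the value at [y != x] of the unit radial field centred
   at [x]. *)
Definition radial x y : 'rV[R]_n := (enorm (y - x))^-1 *: (y - x).

Definition gradE (f : 'rV[R]_n -> R) x : 'rV[R]_n := \row_i 'D_(ebasis i) f x.

End Euclidean.

Section LebesgueRn.
Context {R : realType}.

(* The preimages of Borel sets under the coordinates generate the Borel
   sigma-algebra of R^n. *)
Definition rV_cylinder n : set (set 'rV[R]_n) :=
  [set (fun v : 'rV[R]_n => v 0 i) @^-1` A
    | i in [set: 'I_n] & A in [set A : set (measurableTypeR R) | measurable A]].

Definition rV_measurable n : set (set 'rV[R]_n) := <<s @rV_cylinder n >>.

Let rV_measurable0 n : @rV_measurable n set0.
Proof. exact: sigma_algebra0. Qed.

Let rV_measurableC n (A : set 'rV[R]_n) :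
  rV_measurable A -> rV_measurable (~` A).
Proof. exact: sigma_algebraC. Qed.

Let rV_measurable_bigcup n (F : (set 'rV[R]_n)^nat) :
  (forall i, rV_measurable (F i)) -> rV_measurable (\bigcup_i (F i)).
Proof. exact: sigma_algebra_bigcup. Qed.

HB.instance Definition _ n := @isMeasurable.Build default_measure_display
  'rV[R]_n (@rV_measurable n) (@rV_measurable0 n) (@rV_measurableC n)
  (@rV_measurable_bigcup n).

Definition rV_cons n (t : R) (v : 'rV[R]_n) : 'rV[R]_n.+1 :=
  row_mx (const_mx t : 'rV[R]_1) v.

Lemma rV_cons0 n t (v : 'rV[R]_n) : rV_cons t v 0 0 = t.
Proof.
have -> : 0 = lshift n 0 :> 'I_(1 + n) by exact/val_inj.
exact: etrans (row_mxEl _ _ _ _) (mxE _ _ _ _).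
Qed.

Lemma rV_consS n t (v : 'rV[R]_n) i : rV_cons t v 0 (lift ord0 i) = v 0 i.
Proof.
have -> : lift ord0 i = rshift 1 i :> 'I_(1 + n) by exact/val_inj.
exact: row_mxEr.
Qed.

Lemma measurable_coord n (i : 'I_n) :
  measurable_fun setT (fun v : 'rV[R]_n => v 0 i : measurableTypeR R).
Proof.
move=> _ A mA; rewrite setTI; apply: sub_sigma_algebra.
by exists i => //; exists A.
Qed.

Lemma measurable_rV_cons n :
  measurable_fun setT
    (fun p : measurableTypeR R * 'rV[R]_n => rV_cons p.1 p.2).
Proof.
apply: (@measurability _ _ _ _ setT _ (@rV_cylinder n.+1) erefl).
move=> _ [_ [i _ [A mA <-]] <-]; rewrite -comp_preimage.
suff: measurable_fun setT (fun p : measurableTypeR R * 'rV[R]_n =>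
  rV_cons p.1 p.2 0 i : measurableTypeR R) by exact.
have [j ->|->] := unliftP ord0 i.
- rewrite (_ : (fun _ => _) =
      (fun v : 'rV[R]_n => v 0 j : measurableTypeR R) \o snd).
    exact: (measurableT_comp (measurable_coord j) measurable_snd).
  by apply/funext => p; rewrite /= rV_consS.
- rewrite (_ : (fun _ => _) = fst); first exact: measurable_fst.
  by apply/funext => p; rewrite rV_cons0.
Qed.

Lemma measurable_rV_tail n :
  measurable_fun setT
    (fun v : 'rV[R]_n.+1 => \row_i v 0 (lift ord0 i) : 'rV[R]_n).
Proof.
apply: (@measurability _ _ _ _ setT _ (@rV_cylinder n) erefl).
move=> _ [_ [i _ [A mA <-]] <-]; rewrite -comp_preimage.
rewrite (_ : _ \o _ = fun v : 'rV[R]_n.+1 => v 0 (lift ord0 i)).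
  exact: measurable_coord.
by apply/funext => v /=; rewrite mxE.
Qed.

Section step.
Variables (n : nat) (mu : {sigma_finite_measure set 'rV[R]_n -> \bar R}).

Definition leb_step : set 'rV[R]_n.+1 -> \bar R :=
  pushforward (@lebesgue_measure R \x mu)%E
    (fun p : measurableTypeR R * 'rV[R]_n => rV_cons p.1 p.2).

(* Used implicitly by the measure instance of [pushforward]. *)
Let mcons := @measurable_rV_cons n.

Let leb_step0 : leb_step set0 = 0%E.
Proof. by rewrite /leb_step measure0. Qed.

Let leb_step_ge0 A : (0 <= leb_step A)%E.
Proof. exact: measure_ge0. Qed.

Let leb_step_sigma_additive : semi_sigma_additive leb_step.
Proof. exact: measure_semi_sigma_additive. Qed.

HB.instance Definition _ := isMeasure.Build _ _ _ leb_step
  leb_step0 leb_step_ge0 leb_step_sigma_additive.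

Let leb_step_sigma_finite : sigma_finite setT leb_step.
Proof.
have /sigma_finiteP[F [TF ndF Foo]] := sigma_finiteT (@lebesgue_measure R).
have /sigma_finiteP[G [TG ndG Goo]] := sigma_finiteT mu.
pose tail (v : 'rV[R]_n.+1) : 'rV[R]_n := \row_i v 0 (lift ord0 i).
have tailK t (v : 'rV[R]_n) : tail (rV_cons t v) = v.
  by apply/rowP => i; rewrite mxE rV_consS.
exists (fun k => [set v : 'rV[R]_n.+1 | F k (v 0 0) /\ G k (tail v)]).
  rewrite predeqE => v; split=> // _.
  have [i _ Fi] : (\bigcup_i F i) (v 0 0) by rewrite -TF.
  have [j _ Gj] : (\bigcup_i G i) (tail v) by rewrite -TG.
  exists (maxn i j) => //; split.
    by move: (v 0 0) Fi; exact/subsetPset/ndF/leq_maxl.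
  by move: (tail v) Gj; exact/subsetPset/ndG/leq_maxr.
move=> k; have [mF Fk] := Foo k; have [mG Gk] := Goo k; split.
  apply: measurableI; rewrite -[X in measurable X]setTI.
    exact: (measurable_coord 0 measurableT mF).
  exact: (@measurable_rV_tail n measurableT _ mG).
rewrite /leb_step /pushforward (_ : _ @^-1` _ = F k `*` G k); last first.
  by rewrite predeqE => -[t v] /=; rewrite rV_cons0 tailK.
by rewrite product_measure1E// lte_mul_pinfty// ge0_fin_numE.
Qed.

HB.instance Definition _ := Measure_isSigmaFinite.Build _ _ _ leb_step
  leb_step_sigma_finite.

End step.

Section base.

Definition leb_base : set 'rV[R]_0 -> \bar R := \d_(0 : 'rV[R]_0).

HB.instance Definition _ := Measure.on leb_base.

Let leb_base_sigma_finite : sigma_finite setT leb_base.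
Proof.
exists (fun=> setT); first by rewrite bigcup_const.
by move=> _; split => //; rewrite /leb_base diracT ltry.
Qed.

HB.instance Definition _ := Measure_isSigmaFinite.Build _ _ _ leb_base
  leb_base_sigma_finite.

End base.

(* Lebesgue measure on R^n as an iterated product of Lebesgue measures on R. *)
Fixpoint lebesgue_rV n : {sigma_finite_measure set 'rV[R]_n -> \bar R} :=
  if n is k.+1 then leb_step (lebesgue_rV k) else leb_base.

End LebesgueRn.

Section Sphere.
Context {R : realType} {n : nat}.

(* Integral of [f] over the graph of [h] above [D], with respect to the area
   element [sqrt (1 + |grad h|^2) dv]; the first coordinate is the height. *)
Definition graph_integral (D : set 'rV[R]_n) (h : 'rV[R]_n -> R)
    (f : 'rV[R]_n.+1 -> R) : R :=
  \int[lebesgue_rV n]_(v in D)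
    (f (rV_cons (h v) v) * Num.sqrt (1 + enorm (gradE h v) ^+ 2)).

(* The sphere is the union of two open hemispheres, which are graphs over the
   open equatorial ball, and of the equator, which has no area. In R^1 both
   graphs are points. *)
Definition sphere_integral (x : 'rV[R]_n.+1) (r : R) (f : 'rV[R]_n.+1 -> R)
    : R :=
  let h v := Num.sqrt (r ^+ 2 - enorm v ^+ 2) in
  graph_integral (eball 0 r) h (fun z => f (x + z)) +
  graph_integral (eball 0 r) (fun v => - h v) (fun z => f (x + z)).

End Sphere.

Section Smooth.
Context {R : realType} {n : nat} {W : normedModType R}.

Fixpoint Ck (k : nat) (U : set 'rV[R]_n) (f : 'rV[R]_n -> W) : Prop :=
  match k with
  | 0 => forall x, U x -> {for x, continuous f}
  | k'.+1 => (forall x, U x -> differentiable f x) /\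
             forall i, Ck k' U ('D_(ebasis i) f)
  end.

Definition smooth_on (U : set 'rV[R]_n) (f : 'rV[R]_n -> W) : Prop :=
  forall k, Ck k U f.

End Smooth.

(* The atlas need not be maximal. [chart_inv i] is only meaningful on the image
   of the chart [i]; [chart_at] records that the charts cover the manifold. *)
Record smoothManifold (R : realType) (m : nat) := SmoothManifold {
  mcarrier :> topologicalType;
  mhausdorff : hausdorff_space mcarrier;
  msecond_countable : @second_countable mcarrier;
  chart_index : Type;
  chart_dom : chart_index -> set mcarrier;
  chart : chart_index -> mcarrier -> 'rV[R]_m;
  chart_inv : chart_index -> 'rV[R]_m -> mcarrier;
  chart_at : mcarrier -> chart_index;
  chart_atP : forall p, chart_dom (chart_at p) p;
  chart_dom_open : forall i, open (chart_dom i);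
  chart_img_open : forall i, open (chart i @` chart_dom i);
  chartK : forall i p, chart_dom i p -> chart_inv i (chart i p) = p;
  chart_continuous : forall i p, chart_dom i p -> {for p, continuous (chart i)};
  chart_inv_continuous : forall i u, (chart i @` chart_dom i) u ->
    {for u, continuous (chart_inv i)};
  chart_compatible : forall i j,
    smooth_on (chart i @` (chart_dom i `&` chart_dom j))
              (chart j \o chart_inv i)
}.

Definition chart_img (R : realType) (m : nat) (N : smoothManifold R m)
    (i : chart_index N) : set 'rV[R]_m := chart i @` chart_dom i.

(* Row [a] is the derivative along the [a]-th coordinate of the change of
   coordinates from the chart [i] to the chart [j]. *)
Definition transition_jacobian (R : realType) (m : nat)
    (N : smoothManifold R m) (i j : chart_index N) (u : 'rV[R]_m)
    : 'M[R]_m :=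
  \matrix_(a, b) 'D_(ebasis a) (chart j \o chart_inv i) u 0 b.

(* [gmx i u] is the matrix [g_ab] of the metric in the chart [i], at the point
   of coordinates [u]; [gmx_tensor] makes these matrices define one metric. *)
Record riemannianMetric (R : realType) (m : nat) (N : smoothManifold R m) :=
  RiemannianMetric {
  gmx : chart_index N -> 'rV[R]_m -> 'M[R]_m;
  gmx_smooth : forall i, smooth_on (chart_img i) (gmx i);
  gmx_sym : forall i u, chart_img i u -> (gmx i u)^T = gmx i u;
  gmx_pos : forall i u, chart_img i u ->
    forall v : 'rV[R]_m, v != 0 -> 0 < (v *m gmx i u *m v^T) 0 0;
  gmx_tensor : forall i j p, chart_dom i p -> chart_dom j p ->
    let J := transition_jacobian i j (chart i p) in
    gmx i (chart i p) = J *m gmx j (chart j p) *m J^T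
}.

Section RiemannianGeometry.
Context {R : realType} {m : nat} {N : smoothManifold R m}.
Variable g : riemannianMetric N.
Implicit Types (i : chart_index N) (p : N).

Definition smooth_function (V : N -> R) : Prop :=
  forall i, smooth_on (chart_img i) (V \o chart_inv i).

Definition dgmx i u (a b c : 'I_m) : R := 'D_(ebasis a) (gmx g i) u b c.

(* [christoffel i u a b c] is the symbol with upper index [a] and lower
   indices [b] and [c] of the Levi-Civita connection. *)
Definition christoffel i u (a b c : 'I_m) : R :=
  2^-1 * \sum_(l < m) invmx (gmx g i u) a l *
    (dgmx i u b l c + dgmx i u c l b - dgmx i u l b c).

(* A tangent vector at [p] is given by its components in a chart at [p]. *)
Definition sqnorm i p (v : 'rV[R]_m) : R :=
  (v *m gmx g i (chart i p) *m v^T) 0 0.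

(* Components in the chart [i]. *)
Definition grad i (V : N -> R) p : 'rV[R]_m :=
  \row_a \sum_(b < m) invmx (gmx g i (chart i p)) a b *
    'D_(ebasis b) (V \o chart_inv i) (chart i p).

Section Maps.
Context {n : nat}.
Variable phi : 'rV[R]_n -> N.
Implicit Types x X : 'rV[R]_n.

Definition smooth_map : Prop :=
  continuous phi /\
  forall i, smooth_on (phi @^-1` chart_dom i) (chart i \o phi).

(* The vector [d phi_x (X)], in the chart [i] at [phi x]. *)
Definition dmap i x X : 'rV[R]_m := 'D_X (chart i \o phi) x.

(* [|d phi_x (X)|^2]; the value does not depend on the chart at [phi x]. *)
Definition sqnorm_dmap x X : R :=
  sqnorm (chart_at (phi x)) (phi x) (dmap (chart_at (phi x)) x X).

(* [|d phi|^2], the trace of the pulled back metric. *)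
Definition energy_density x : R := \sum_(j < n) sqnorm_dmap x (ebasis j).

(* [(nabla d phi)_x (e_j, e_k)], in the chart [i] at [phi x]; the Christoffel
   symbols of R^n vanish in the standard coordinates. *)
Definition second_fundamental_form i x (j k : 'I_n) : 'rV[R]_m :=
  \row_a ('D_(ebasis j) ('D_(ebasis k) (chart i \o phi)) x 0 a +
    \sum_(b < m) \sum_(c < m) christoffel i (chart i (phi x)) a b c *
      dmap i x (ebasis j) 0 b * dmap i x (ebasis k) 0 c).

Definition tension_field i x : 'rV[R]_m :=
  \sum_(j < n) second_fundamental_form i x j j.

Definition harmonic_map_with_potential (V : N -> R) : Prop :=
  smooth_map /\
  forall i x, chart_dom i (phi x) -> tension_field i x = - grad i V (phi x).

End Maps.
End RiemannianGeometry.

(* Main.v *)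
Require Import Defs.
From mathcomp Require Import all_boot all_order all_algebra.
From mathcomp Require Import all_classical all_reals all_analysis.
From mathcomp Require Import measurable_realfun ring lra.

Set Implicit Arguments.
Unset Strict Implicit.
Unset Printing Implicit Defensive.
Import Order.TTheory GRing.Theory Num.Theory.
Import numFieldNormedType.Exports.
Local Open Scope classical_set_scope.
Local Open Scope ring_scope.

(** Write [e = |dphi|^2 / 2 - V(phi)] and [T_jk = <d_j phi, d_k phi>].  The
    stress-energy tensor [S = e delta - T] of a harmonic map with potential is
    divergence free.  Indeed, in a chart of the target the metric compatibility
    of the Levi-Civita connection ([christoffel_contract]) and the symmetry of
    second derivatives ([mixed_derivatives]) give
      [sum_j d_j T_jk = <tau(phi), d_k phi> + d_k (|dphi|^2 / 2)],
    and [<tau(phi), d_k phi> = - <grad V, d_k phi> = - d_k (V o phi)]; this is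
    [conservation_chart].

    In dimension [N], the field [X_j = sum_k S_jk (y - x)_k] therefore has
    divergence [tr S = (N - 2) e - 2 V(phi)], and on the sphere of radius [r]
    its scalar product with [y - x] is [r^2 (e - |dphi/dr|^2)].  The divergence
    theorem turns this into
      [(N - 2) int_B e - 2 int_B V(phi) = r int_S (e - |dphi/dr|^2)]
    ([pohozaev_identity]).  As the derivative in [r] of [int_B e] is [int_S e],
    the product rule applied to [r^(2-N) int_B e] gives the theorem
    ([pohozaev]).

    Both facts about balls are obtained from the description of a sphere as the
    union of two graphs.

    For the derivative of a ball integral ([is_derive_eball]), the ball is cut
    into lines parallel to the first axis, and on each half line the height [t]
    over the point [v] of the equatorial plane is replaced by the radius [p],
    [t = sqrt (p^2 - |v|^2)].  Exchanging the integrals writes the integral over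
    a ball as the integral in [p] of the integrals over hemispheres
    ([integral_ball_hemispheres]).  The area element [p / sqrt (p^2 - |v|^2)]
    blows up on the equator.  After rescaling to the unit ball the singular
    factor is the fixed function [1 / sqrt (1 - |w|^2)], and dominated
    convergence shows that the sphere integral is continuous in [p], so that the
    fundamental theorem of calculus applies.  That this function is integrable
    is read off from the same formula for a constant integrand: the volume of
    the unit ball is finite.

    For the divergence theorem ([divergence_eball]), no boundary term has to be
    computed: the field [(s^2 - |y|^2) X] vanishes on the sphere of radius [s],
    so its divergence has integral [0] over the ball
    ([integral_derive_eball], by Fubini and induction on the dimension).  Hence
      [s^2 int_B div X - int_B |y|^2 div X = 2 int_B y . X],
    and differentiating in [s] makes the two sphere integrals of [div X] cancel:
    [2 s int_B div X = 2 int_S y . X]. *)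

(** * Iterated Lebesgue measure on Euclidean space *)

Section Measure.
Context {R : realType}.
Local Notation mu := (@lebesgue_measure R).
Local Notation leb := (@lebesgue_rV R).

Lemma measurable_comp_rV_cons n (f : 'rV[R]_n.+1 -> \bar R) :
  measurable_fun setT f ->
  measurable_fun setT
    (fun p : measurableTypeR R * 'rV[R]_n => f (rV_cons p.1 p.2)).
Proof. move=> mf; exact: (measurableT_comp mf (@measurable_rV_cons R n)). Qed.

Lemma ge0_integral_rV_cons n (f : 'rV[R]_n.+1 -> \bar R) :
  measurable_fun setT f -> (forall v, 0 <= f v)%E ->
  (\int[leb n.+1]_v f v =
   \int[mu]_t \int[leb n]_v f (rV_cons (t : R) v))%E.
Proof.
move=> mf f0; rewrite /= /leb_step.
rewrite (ge0_integral_pushforward (@measurable_rV_cons R n))//=.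
rewrite preimage_setT fubini_tonelli1//.
exact: measurable_comp_rV_cons.
Qed.

Lemma ge0_integral_rV_cons_swap n (f : 'rV[R]_n.+1 -> \bar R) :
  measurable_fun setT f -> (forall v, 0 <= f v)%E ->
  (\int[leb n.+1]_v f v =
   \int[leb n]_v \int[mu]_t f (rV_cons (t : R) v))%E.
Proof.
move=> mf f0; rewrite /= /leb_step.
rewrite (ge0_integral_pushforward (@measurable_rV_cons R n))//=.
rewrite preimage_setT fubini_tonelli2//.
exact: measurable_comp_rV_cons.
Qed.

Lemma rV_cons_eta n (a : 'rV[R]_n.+1) :
  rV_cons (a 0 0) (\row_i a 0 (lift ord0 i)) = a.
Proof.
apply/rowP => i; have [j ->|->] := unliftP ord0 i.
  by rewrite rV_consS mxE.
by rewrite rV_cons0.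
Qed.

Lemma rV_consD n (s t : R) (u v : 'rV[R]_n) :
  rV_cons s u + rV_cons t v = rV_cons (s + t) (u + v).
Proof.
apply/rowP => i; rewrite mxE; have [j ->|->] := unliftP ord0 i.
  by rewrite !rV_consS mxE.
by rewrite !rV_cons0.
Qed.

Lemma rV_consZ n (k t : R) (v : 'rV[R]_n) :
  k *: rV_cons t v = rV_cons (k * t) (k *: v).
Proof.
apply/rowP => i; rewrite mxE; have [j ->|->] := unliftP ord0 i.
  by rewrite !rV_consS mxE.
by rewrite !rV_cons0.
Qed.

Lemma measurable_affine (a k : R) :
  measurable_fun setT (fun t : R => a + k * t : measurableTypeR R).
Proof.
by apply: measurable_funD; [exact: measurable_cst|exact: mulrl_measurable].
Qed.

Lemma measurable_rV_fun d (T : measurableType d) n (F : T -> 'rV[R]_n) :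
  (forall i, measurable_fun setT (fun v => F v 0 i : measurableTypeR R)) ->
  measurable_fun setT F.
Proof.
move=> mF; apply: (@measurability _ _ _ _ setT _ (@rV_cylinder R n) erefl).
by move=> _ [_ [i _ [A mA <-]] <-]; rewrite -comp_preimage; exact: mF.
Qed.

Lemma measurable_rV_affine n (a : 'rV[R]_n) (k : R) :
  measurable_fun setT (fun v : 'rV[R]_n => a + k *: v).
Proof.
apply: measurable_rV_fun => i.
apply: (eq_measurable_fun (fun v : 'rV[R]_n => a 0 i + k * v 0 i)).
  by move=> v _; rewrite !mxE.
exact: (measurableT_comp (measurable_affine _ _) (measurable_coord i)).
Qed.

(** Both sides, as functions of [A], are measures that agree on intervals. *)
Lemma lebesgue_affine (a k : R) (k0 : 0 < k) (A : set R) :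
  measurable A ->
  (mu A = k%:E * mu ((fun t : R => (a + k * t)%R) @^-1` A))%E.
Proof.
move=> mA.
pose phi : measurableTypeR R -> measurableTypeR R := fun t => a + k * t.
have mphi : measurable_fun setT phi by exact: measurable_affine.
pose nu0 := mscale (NngNum (ltW k0)) (pushforward mu phi).
pose nu : {measure set (measurableTypeR R) -> \bar R} := nu0 mphi.
rewrite (@lebesgue_measure_unique R nu)// => _ [[b c] _ <-].
rewrite /nu /nu0 /= /mscale/= /pushforward.
rewrite (_ : phi @^-1` _ = `](b - a) / k, (c - a) / k]%classic); last first.
  apply/seteqP; split => t /=; rewrite !in_itv/= /phi ltr_pdivrMr// ler_pdivlMr//;
  by rewrite ltrBlDl lerBrDl mulrC.
rewrite !lebesgue_measure_itv/= !lte_fin ltr_pM2r ?invr_gt0// ltrBlDr subrK.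
case: ifPn => // _; last by rewrite mule0.
rewrite -!EFinB -EFinM; congr EFin; field; exact: lt0r_neq0.
Qed.

Lemma ge0_integral_affine1 (a k : R) (f : R -> \bar R) : 0 < k ->
  measurable_fun setT f -> (forall t, 0 <= f t)%E ->
  (k%:E * \int[mu]_t f (a + k * t)%R = \int[mu]_t f t)%E.
Proof.
move=> k0 mf f0.
pose phi : measurableTypeR R -> measurableTypeR R := fun t => a + k * t.
have mphi : measurable_fun setT phi by exact: measurable_affine.
pose nu0 := mscale (NngNum (ltW k0)) (pushforward mu phi).
pose nu : {measure set (measurableTypeR R) -> \bar R} := nu0 mphi.
rewrite [RHS](@eq_measure_integral _ _ _ _ nu); last first.
  by move=> A mA _; exact: lebesgue_affine.
by rewrite ge0_integral_mscale// (ge0_integral_pushforward mphi).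
Qed.

(** The change of variables is made one coordinate at a time, along the
    recursive definition of the measure. *)
Lemma ge0_integral_affine n (a : 'rV[R]_n) (k : R) (f : 'rV[R]_n -> \bar R) :
  0 < k -> measurable_fun setT f -> (forall v, 0 <= f v)%E ->
  ((k ^+ n)%:E * \int[leb n]_v f (a + k *: v)%R = \int[leb n]_v f v)%E.
Proof.
move=> k0; elim: n a f => [|n IHn] a f mf f0.
  rewrite expr0 mul1e; apply: eq_integral => v _; congr f.
  by apply/rowP => -[].
rewrite ge0_integral_rV_cons//; last first.
  exact: (measurableT_comp mf (measurable_rV_affine a k)).
pose a' : 'rV[R]_n := \row_i a 0 (lift ord0 i).
transitivity ((k ^+ n.+1)%:E *
  \int[mu]_t \int[leb n]_v f (rV_cons (a 0 0 + k * t)%R (a' + k *: v)%R))%E.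
  congr (_ * _)%E; apply: eq_integral => t _; apply: eq_integral => v _.
  by rewrite rV_consZ -{1}(rV_cons_eta a) rV_consD.
have mft t : measurable_fun setT (fun v : 'rV[R]_n => f (rV_cons t v)).
  exact: (measurableT_comp (measurable_comp_rV_cons mf) (measurable_pair1 t)).
pose G t := (\int[leb n]_v f (rV_cons t v))%E.
have mG : measurable_fun setT G.
  by have := measurable_fun_fubini_tonelli_F _ (measurable_comp_rV_cons mf); apply.
have G0 t : (0 <= G t)%E by exact: integral_ge0.
rewrite ge0_integral_rV_cons// -/G -[RHS](ge0_integral_affine1 (a 0 0) k0)//.
rewrite exprS EFinM -muleA; congr (_ * _)%E.
rewrite -ge0_integralZl//=; last 3 first.
- pose h (p : measurableTypeR R * 'rV[R]_n) : \bar R :=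
    f (rV_cons (a 0 0 + k * p.1) (a' + k *: p.2)).
  apply: (measurable_fun_fubini_tonelli_F (m2 := leb n) h); last first.
    by move=> p; exact: f0.
  rewrite (_ : h = (fun p => f (rV_cons p.1 p.2)) \o
      (fun p => (a 0 0 + k * p.1, a' + k *: p.2)))//.
  apply: (measurableT_comp (measurable_comp_rV_cons mf)).
  apply: measurable_fun_pair.
    exact: (measurableT_comp (measurable_affine _ _) measurable_fst).
  exact: (measurableT_comp (measurable_rV_affine _ _) measurable_snd).
- by move=> t _; exact: integral_ge0.
- by rewrite lee_fin exprn_ge0 ?ltW.
apply: eq_integral => t _; exact: (IHn _ (fun v => f (rV_cons _ v))).
Qed.

End Measure.

(** * Continuous functions and Euclidean balls *)

Section Continuous.
Context {R : realType}.
Local Notation mu := (@lebesgue_measure R).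
Local Notation leb := (@lebesgue_rV R).

(** A continuous function is the pointwise limit of its values at the lower
    corners of the cells of finer and finer cubic grids; each of these step
    functions has countably many level sets, all of them products of
    intervals. *)
Let grid n k (z : 'rV[int]_n) : 'rV[R]_n := \row_i ((z 0 i)%:~R / k.+1%:R).
Let cell n k (v : 'rV[R]_n) : 'rV[int]_n :=
  \row_i Num.floor (v 0 i * k.+1%:R).

Let measurable_cell n k (z : 'rV[int]_n) :
  measurable [set v : 'rV[R]_n | cell k v = z].
Proof.
rewrite (_ : [set v | _] = \bigcap_(i in [set: 'I_n])
    ((fun v : 'rV[R]_n => v 0 i) @^-1`
     ((fun t => (Num.floor (t * k.+1%:R))%:~R) @^-1` [set (z 0 i)%:~R : R])));
    last first.
  apply/seteqP; split => v /=.
    by move=> <- i _ /=; rewrite mxE.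
  by move=> vz; apply/rowP => i; rewrite mxE; exact/(@intr_inj R)/(vz i).
apply: fin_bigcap_measurable => [|i _]; first exact: finite_finset.
rewrite -[X in measurable X]setTI; apply: measurable_coord => //.
rewrite -[X in measurable X]setTI.
apply: (nondecreasing_measurable _ _ measurableT); rewrite // => s t st.
by rewrite ler_int; apply: le_floor; rewrite ler_pM2r.
Qed.

Let cvg_grid n (v : 'rV[R]_n) : (fun k => grid k (cell k v)) @ \oo --> v.
Proof.
apply/cvgrPdist_le => /= e e0; near=> k.
rewrite [leLHS]/Num.Def.normr/= mx_normrE (bigmax_le _ (ltW e0))//= => -[i j] _.
rewrite !mxE /= (ord1 i).
have k0 : 0 < k.+1%:R :> R by [].
rewrite -[X in `|X - _|](mulfK (lt0r_neq0 k0)) -mulrBl normrM normfV.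
rewrite (gtr0_norm k0) ler_pdivrMr//.
apply: (@le_trans _ _ 1).
  have /andP[fl fr] := floor_itv (v 0 j * k.+1%:R).
  by rewrite ger0_norm ?subr_ge0// lerBlDl ltW// -[1]/(1%:~R) -intrD.
rewrite -ler_pdivrMl// mulr1; apply: le_trans (_ : k%:R <= _);
  last by rewrite ler_nat.
near: k; exact: nbhs_infty_ger.
Unshelve. all: by end_near. Qed.

Lemma continuous_measurable_rV n (f : 'rV[R]_n -> R) :
  continuous f -> measurable_fun setT f.
Proof.
move=> cf; apply: (@measurable_fun_cvg _ _ _ _ (fun k v => f (grid k (cell k v)))).
  move=> k _ A mA; rewrite setTI.
  rewrite [X in measurable X](_ : _ = \bigcup_(z in [set z | A (f (grid k z))])
                             [set v | cell k v = z]).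
    rewrite bigcup_mkcond; apply: countable_bigcupT_measurable => // z.
    by case: ifP => _; [exact: measurable_cell|exact: measurable0].
  apply/seteqP; split => [v Av|v [z /= Az vz]]; first by exists (cell k v).
  by rewrite /= vz.
move=> v _ /=; apply: (@cvg_comp _ _ _ (fun k => grid k (cell k v)) f).
  exact: cvg_grid.
exact: cf.
Qed.

Lemma enorm_ge0 n (v : 'rV[R]_n) : 0 <= enorm v.
Proof. exact: sqrtr_ge0. Qed.

Lemma sqr_enorm n (v : 'rV[R]_n) : enorm v ^+ 2 = \sum_i v 0 i ^+ 2.
Proof. by rewrite sqr_sqrtr// sumr_ge0// => i _; exact: sqr_ge0. Qed.

Lemma sqr_enorm_cons n (t : R) (v : 'rV[R]_n) :
  enorm (rV_cons t v) ^+ 2 = t ^+ 2 + enorm v ^+ 2.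
Proof.
rewrite !sqr_enorm big_ord_recl rV_cons0; congr (_ + _).
by apply: eq_bigr => i _; rewrite rV_consS.
Qed.

Lemma enormZ n (k : R) (v : 'rV[R]_n) : enorm (k *: v) = `|k| * enorm v.
Proof.
apply/eqP; rewrite -(@eqrXn2 _ 2) ?mulr_ge0 ?enorm_ge0//.
rewrite exprMn !sqr_enorm real_normK ?num_real// mulr_sumr; apply/eqP.
by apply: eq_bigr => i _; rewrite mxE exprMn.
Qed.

Lemma coord_le_enorm n (v : 'rV[R]_n) i : `|v 0 i| <= enorm v.
Proof.
rewrite -[leLHS]sqrtr_sqr -/(enorm v) ler_wsqrtr// (bigD1 i)//= lerDl.
by apply: sumr_ge0 => j _; exact: sqr_ge0.
Qed.

Lemma continuous_sqr_enorm n : continuous (fun v : 'rV[R]_n => enorm v ^+ 2).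
Proof.
rewrite (_ : (fun _ => _) = fun v : 'rV[R]_n => \sum_i v 0 i ^+ 2); last first.
  by apply/funext => v; rewrite sqr_enorm.
apply: continuous_big => [|i _ v]; first exact: add_continuous.
apply: (@continuous_comp _ _ _ (fun v : 'rV[R]_n => v 0 i) (fun t => t ^+ 2)).
  exact: coord_continuous.
exact: exprn_continuous.
Qed.

Lemma continuous_enorm n : continuous (@enorm R n).
Proof.
rewrite (_ : @enorm R n = Num.sqrt \o (fun v : 'rV[R]_n => enorm v ^+ 2)).
  move=> v; apply: continuous_comp; first exact: continuous_sqr_enorm.
  exact: sqrt_continuous.
by apply/funext => v /=; rewrite sqrtr_sqr ger0_norm// enorm_ge0.
Qed.

Lemma continuous_enormB n (x : 'rV[R]_n) :
  continuous (fun y : 'rV[R]_n => enorm (y - x)).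
Proof.
move=> y; apply: (@continuous_comp _ _ _ (fun y : 'rV[R]_n => y - x) (@enorm R n)).
  by apply: continuousB; [exact: (@cvg_id _ (nbhs y))|exact: cst_continuous].
exact: continuous_enorm.
Qed.

Lemma measurable_eball n (x : 'rV[R]_n) r : measurable (eball x r).
Proof.
rewrite (_ : eball x r =
    setT `&` (fun y : 'rV[R]_n => enorm (y - x)) @^-1` `]-oo, r[%classic).
  apply: (continuous_measurable_rV (@continuous_enormB n x)) => //.
by apply/seteqP; split => y /=; rewrite in_itv//= => -[].
Qed.

Lemma eball_scale n (x : 'rV[R]_n) k r v : 0 < k ->
  eball x (k * r) (x + k *: v) = eball 0 r v.
Proof.
move=> k0; rewrite /eball/= addrAC subrr add0r subr0 enormZ gtr0_norm//.
by rewrite ltr_pM2l.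
Qed.

Lemma bounded_eball n (x : 'rV[R]_n) r (f : 'rV[R]_n -> R) :
  continuous f -> exists M, forall y, eball x r y -> `|f y| <= M.
Proof.
move=> cf.
have cK : compact [set y : 'rV[R]_n | enorm (y - x) <= r].
  apply: bounded_closed_compact.
    exists (r + `|x|); split; first exact: num_real.
    move=> M rM y /= yr; apply: le_trans (ltW rM).
    rewrite -lerBlDr (le_trans (lerB_dist _ _))// (le_trans _ yr)//.
    rewrite [leLHS]/Num.Def.normr/= mx_normrE (bigmax_le _ (enorm_ge0 _))//=.
    by move=> -[i j] _ /=; rewrite (ord1 i); exact: coord_le_enorm.
  rewrite (_ : [set y | _] =
      (fun y : 'rV[R]_n => enorm (y - x)) @^-1` [set t | t <= r])//.
  apply: preimage_closed; last exact: closed_le.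
  by move=> y _; exact: continuous_enormB.
have /compact_bounded[M [_ fM]] : compact (f @` [set y | enorm (y - x) <= r]).
  by apply: continuous_compact => //; exact: continuous_subspaceT.
exists (M + 1) => y yr; apply: fM; first by rewrite ltrDl.
by exists y => //; exact: ltW.
Qed.

(** A ball is contained in the product of an interval and a ball of one
    dimension less. *)
Lemma lebesgue_eball_fin n (x : 'rV[R]_n) r : (leb n (eball x r) < +oo)%E.
Proof.
elim: n x => [|n IHn] x.
  by rewrite /= /leb_base diracE ltry.
pose x' : 'rV[R]_n := \row_i x 0 (lift ord0 i).
rewrite /= /leb_step /pushforward.
apply: (@le_lt_trans _ _ ((mu \x leb n)%E
    (`[x 0 0 - r, x 0 0 + r]%classic `*` eball x' r))).
  apply: le_measure; rewrite ?inE.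
  - rewrite -[X in measurable X]setTI; apply: measurable_rV_cons => //.
    exact: measurable_eball.
  - by apply: measurableX => //; exact: measurable_eball.
  move=> -[t v] /=; rewrite /eball/= => tv; split.
    rewrite in_itv/= -ler_distl; apply: ltW; apply: le_lt_trans tv.
    by have := coord_le_enorm (rV_cons t v - x) 0; rewrite mxE rV_cons0 mxE.
  apply: le_lt_trans tv; rewrite -(@ler_pXn2r _ 2) ?nnegrE ?enorm_ge0//.
  rewrite !sqr_enorm [leRHS]big_ord_recl -[leLHS]add0r lerD ?sqr_ge0//.
  apply: ler_sum => i _.
  have -> // : (rV_cons t v - x) 0 (lift ord0 i) = (v - x') 0 i.
  by rewrite mxE rV_consS !mxE.
rewrite product_measure1E//; last exact: measurable_eball.
apply: lte_mul_pinfty; [exact: measure_ge0| |exact: IHn].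
rewrite (_ : _ `[_, _]%classic = mu `[x 0 0 - r, x 0 0 + r]%classic)//.
by rewrite lebesgue_measure_itv/=; case: ifP.
Qed.

Lemma integrable_eball n (x : 'rV[R]_n) r (f : 'rV[R]_n -> R) :
  continuous f -> (leb n).-integrable (eball x r) (EFin \o f).
Proof.
move=> cf; apply: measurable_bounded_integrable.
- exact: measurable_eball.
- exact: lebesgue_eball_fin.
- by apply: measurable_funTS; exact: continuous_measurable_rV.
have [M fM] := bounded_eball x r cf.
exists M; split; first exact: num_real.
by move=> M' /ltW MM' y /= /fM yM; exact: le_trans yM MM'.
Qed.

End Continuous.

(** * Integrals of partial derivatives over balls *)

Section Flux.
Context {R : realType}.
Local Notation mu := (@lebesgue_measure R).
Local Notation leb := (@lebesgue_rV R).

Let integrable_cons n (f : 'rV[R]_n.+1 -> \bar R) :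
  (leb n.+1).-integrable setT f ->
  (mu \x leb n)%E.-integrable setT
    (fun p : measurableTypeR R * 'rV[R]_n => f (rV_cons p.1 p.2)).
Proof.
move=> /integrableP[mf foo]; apply/integrableP; split.
  exact: measurable_comp_rV_cons.
apply: le_lt_trans foo; rewrite /= /leb_step.
rewrite (ge0_integral_pushforward (@measurable_rV_cons R n))//=.
by apply: measurableT_comp => //.
Qed.

Lemma integral_rV_cons n (f : 'rV[R]_n.+1 -> \bar R) :
  (leb n.+1).-integrable setT f ->
  (\int[leb n.+1]_v f v =
   \int[mu]_t \int[leb n]_v f (rV_cons (t : R) v))%E.
Proof.
move=> intf; have intc := integrable_cons intf.
have := integral12_prod_meas1 intc; rewrite /fubini_F => ->.
rewrite /= /leb_step (integral_pushforward (@measurable_rV_cons R n))//.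
exact: measurable_int intf.
Qed.

Lemma integral_rV_cons_swap n (f : 'rV[R]_n.+1 -> \bar R) :
  (leb n.+1).-integrable setT f ->
  (\int[leb n.+1]_v f v =
   \int[leb n]_v \int[mu]_t f (rV_cons (t : R) v))%E.
Proof.
move=> intf; have intc := integrable_cons intf.
have := integral21_prod_meas1 intc; rewrite /fubini_G => ->.
rewrite /= /leb_step (integral_pushforward (@measurable_rV_cons R n))//.
exact: measurable_int intf.
Qed.

Lemma eball0E n (s : R) (v : 'rV[R]_n) : 0 <= s ->
  eball 0 s v <-> enorm v ^+ 2 < s ^+ 2.
Proof.
by move=> s0; rewrite /eball/= subr0 ltr_pXn2r// nnegrE enorm_ge0.
Qed.

(** When the slice misses the ball, the square root of the negative number is
    [0], and a ball of radius [0] is empty too. *)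
Lemma eball_cons n (s t : R) (v : 'rV[R]_n) : 0 <= s ->
  eball 0 s (rV_cons t v) <-> eball 0 (Num.sqrt (s ^+ 2 - t ^+ 2)) v.
Proof.
move=> s0; rewrite !eball0E ?sqrtr_ge0// sqr_enorm_cons.
have [st|st] := leP 0 (s ^+ 2 - t ^+ 2).
  by rewrite (sqr_sqrtr st) ltrBrDl.
rewrite ltr0_sqrtr// expr0n/=; split; last by rewrite ltNge sqr_ge0.
by rewrite -ltrBrDl => /lt_trans/(_ st); rewrite ltNge sqr_ge0.
Qed.

Lemma eball_cons_height n (s t : R) (v : 'rV[R]_n) : 0 <= s ->
  eball 0 s (rV_cons t v) <-> `|t| < Num.sqrt (s ^+ 2 - enorm v ^+ 2).
Proof.
move=> s0; rewrite eball0E// sqr_enorm_cons.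
rewrite -ltrBrDr -[t ^+ 2]real_normK ?num_real//.
have [st|st] := leP 0 (s ^+ 2 - enorm v ^+ 2).
  by rewrite -{1}(sqr_sqrtr st) ltr_pXn2r// nnegrE sqrtr_ge0.
rewrite ltr0_sqrtr//; split; last by rewrite ltNge normr_ge0.
by move=> /lt_trans/(_ st); rewrite ltNge sqr_ge0.
Qed.

Lemma ebasis_cons0 n (k t : R) (v : 'rV[R]_n) :
  k *: ebasis 0 + rV_cons t v = rV_cons (k + t) v.
Proof.
apply/rowP => i; rewrite mxE; have [j ->|->] := unliftP ord0 i.
  by rewrite !rV_consS !mxE/= mulr0 add0r.
by rewrite !rV_cons0 !mxE/= mulr1.
Qed.

Lemma ebasis_consS n i (k t : R) (v : 'rV[R]_n) :
  k *: ebasis (lift ord0 i) + rV_cons t v = rV_cons t (k *: ebasis i + v).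
Proof.
apply/rowP => l; rewrite mxE; have [j ->|->] := unliftP ord0 l.
  by rewrite !rV_consS !mxE/= (inj_eq lift_inj).
by rewrite !rV_cons0 !mxE/= mulr0 add0r.
Qed.

Lemma derivable_cons0 n (F : 'rV[R]_n.+1 -> R) t v :
  derivable F (rV_cons t v) (ebasis 0) ->
  derivable (fun s => F (rV_cons s v)) t 1.
Proof.
rewrite /derivable /=.
by under eq_fun do rewrite ebasis_cons0 -[X in X + t]mulr1.
Qed.

Lemma derive_cons0 n (F : 'rV[R]_n.+1 -> R) t v :
  'D_1 (fun s => F (rV_cons s v)) t = 'D_(ebasis 0) F (rV_cons t v).
Proof.
rewrite /derive /=.
by under [in RHS]eq_fun do rewrite ebasis_cons0 -[X in X + t]mulr1.
Qed.

Lemma derivable_consS n i (F : 'rV[R]_n.+1 -> R) t v :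
  derivable F (rV_cons t v) (ebasis (lift ord0 i)) ->
  derivable (F \o rV_cons t) v (ebasis i).
Proof. by rewrite /derivable /=; under eq_fun do rewrite ebasis_consS. Qed.

Lemma derive_consS n i (F : 'rV[R]_n.+1 -> R) t v :
  'D_(ebasis i) (F \o rV_cons t) v =
  'D_(ebasis (lift ord0 i)) F (rV_cons t v).
Proof.
by rewrite /derive /=; under [in RHS]eq_fun do rewrite ebasis_consS.
Qed.

Lemma continuous_rV n (T : topologicalType) (F : T -> 'rV[R]_n) :
  (forall i, continuous (fun t => F t 0 i)) -> continuous F.
Proof.
move=> cF t; apply/cvgrPdist_le => /= e e0; near=> u.
rewrite [leLHS]/Num.Def.normr/= mx_normrE (bigmax_le _ (ltW e0))//= => -[i j] _.
rewrite !mxE (ord1 i) /=.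
move: j; near: u; apply: filter_forall => /= j.
exact: ((cvgrPdist_le _ _).1 (cF j t)).
Unshelve. all: by end_near. Qed.

Lemma continuous_rV_cons n (T : topologicalType) (a : T -> R)
    (b : T -> 'rV[R]_n) :
  continuous a -> continuous b -> continuous (fun u => rV_cons (a u) (b u)).
Proof.
move=> ca cb; apply: continuous_rV => i.
have [j ->|->] := unliftP ord0 i.
  under eq_fun do rewrite rV_consS.
  move=> u; apply: (@continuous_comp _ _ _ b (fun v : 'rV[R]_n => v 0 j)).
    exact: cb.
  exact: coord_continuous.
by under eq_fun do rewrite rV_cons0.
Qed.

Lemma continuous_rV_consl n (v : 'rV[R]_n) : continuous (fun t => rV_cons t v).
Proof.
apply: (@continuous_rV_cons n _ (fun t : R => t) (fun=> v)) => u.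
  exact: (@cvg_id _ (nbhs u)).
exact: cvg_cst.
Qed.

Lemma continuous_rV_consr n (t : R) : continuous (@rV_cons R n t).
Proof.
apply: (@continuous_rV_cons n _ (fun=> t) (fun v : 'rV[R]_n => v)) => u.
  exact: (@cst_continuous _ _ t u).
exact: (@cvg_id _ (nbhs (u : 'rV[R]_n))).
Qed.

(** Along the first axis this is the fundamental theorem of calculus on each
    vertical chord, whose ends are on the sphere.  For another axis, every
    horizontal slice of the ball is a ball of one dimension less on whose
    boundary [F] vanishes. *)
Lemma integral_derive_eball n (i : 'I_n) (s : R) (F : 'rV[R]_n -> R) :
  0 <= s -> (forall y, derivable F y (ebasis i)) ->
  continuous ('D_(ebasis i) F) -> (forall y, enorm y = s -> F y = 0) ->
  (\int[leb n]_(y in eball 0 s) ('D_(ebasis i) F y)%:E = 0)%E.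
Proof.
elim: n i s F => [[]//|n IHn] i s F s0 dF cF F0.
set g := 'D_(ebasis i) F.
have intg : (leb n.+1).-integrable setT ((EFin \o g) \_ (eball 0 s)).
  apply/(integrable_mkcond _ (measurable_eball 0 s)).
  exact: integrable_eball.
rewrite integral_mkcond; move: intg; rewrite /g.
have [j ij|i0] := unliftP ord0 i; rewrite ?ij ?i0 => intg.
  rewrite integral_rV_cons//; apply: integral0_eq => t _.
  set h : R := Num.sqrt (s ^+ 2 - t ^+ 2).
  transitivity (\int[leb n]_(v in eball 0 h)
      ('D_(ebasis j) (F \o rV_cons t) v)%:E)%E.
    rewrite [RHS]integral_mkcond; apply: eq_integral => v _.
    rewrite !patchE derive_consS /=.
    have E := eball_cons t v s0.
    by case: ifPn; case: ifPn; rewrite ?inE ?notin_setE -/h => h1 h2 //;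
      exfalso; tauto.
  have [st|st] := leP 0 (s ^+ 2 - t ^+ 2); last first.
    rewrite (_ : eball 0 h = set0) ?integral_set0//.
    rewrite -subset0 => v; rewrite /eball/= /h ltr0_sqrtr//.
    by rewrite ltNge enorm_ge0.
  apply: IHn; rewrite ?sqrtr_ge0//.
  - by move=> v; apply: derivable_consS; rewrite -ij.
  - rewrite (_ : 'D__ _ = fun v => 'D_(ebasis i) F (rV_cons t v)).
      move=> v.
      apply: (@continuous_comp _ _ _ (rV_cons t) ('D_(ebasis i) F)); last exact: cF.
      exact: continuous_rV_consr.
    by apply/funext => v; rewrite derive_consS ij.
  - move=> v vh; apply: F0; apply/eqP.
    rewrite -(@eqrXn2 _ 2) ?enorm_ge0// sqr_enorm_cons vh sqr_sqrtr//.
    by rewrite addrC subrK.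
rewrite integral_rV_cons_swap//; apply: integral0_eq => v _.
set h : R := Num.sqrt (s ^+ 2 - enorm v ^+ 2).
transitivity (\int[mu]_(t in `](- h)%R, h[%classic)
    ('D_(ebasis 0) F (rV_cons t v))%:E)%E.
  rewrite [RHS]integral_mkcond; apply: eq_integral => t _.
  rewrite !patchE /=.
  have E := eball_cons_height t v s0.
  by case: ifPn; case: ifPn;
    rewrite ?inE ?notin_setE -/h /= in_itv/= -ltr_norml => h1 h2 //; exfalso; tauto.
have [st|st] := ltP 0 (s ^+ 2 - enorm v ^+ 2); last first.
  have -> : h = 0 by apply/eqP; rewrite sqrtr_eq0.
  by rewrite set_itv_ge ?integral_set0// bnd_simp oppr0 ltxx.
have h0 : 0 < h by rewrite sqrtr_gt0.
have Fh t : `|t| = h -> F (rV_cons t v) = 0.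
  move=> th; apply: F0; apply/eqP.
  rewrite -(@eqrXn2 _ 2) ?enorm_ge0// sqr_enorm_cons.
  by rewrite -[t ^+ 2]real_normK ?num_real// th sqr_sqrtr ?ltW// subrK.
have dF1 t : derivable (fun s => F (rV_cons s v)) t 1.
  by apply: derivable_cons0; move: (dF (rV_cons t v)); rewrite i0.
have cg : continuous (fun t => 'D_(ebasis 0) F (rV_cons t v)).
  move=> t; apply: (@continuous_comp _ _ _
    (fun t : R => rV_cons t v) ('D_(ebasis 0) F)).
    exact: continuous_rV_consl.
  by move: (cF (rV_cons t v)); rewrite i0.
rewrite -(@integral_itv_bndoo _ _ _ _ true false); last first.
  apply/measurable_EFinP/measurable_funTS.
  exact: (@continuous_measurable_fun _ _ cg).
have cFv : continuous (fun t => F (rV_cons t v)).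
  by move=> t; apply/differentiable_continuous/derivable1_diffP/dF1.
rewrite (@continuous_FTC2 _ _ (fun s => F (rV_cons s v))).
- by rewrite !Fh ?normrN ?gtr0_norm// subee.
- by rewrite gtrN.
- exact: continuous_subspaceT.
- split => [t _||]; first exact: dF1.
    exact/cvg_at_right_filter/cFv.
  exact/cvg_at_left_filter/cFv.
- by move=> t _; rewrite derive1E derive_cons0.
Qed.

End Flux.

(** * Hemispheres and polar slicing of balls *)

(** The inverse is discontinuous at [0]; it agrees on nonnegative numbers, [0]
    included, with the power function of exponent [-1], which is measurable. *)
Lemma measurable_sqrtV (R : realType) :
  measurable_fun setT (fun t : R => (Num.sqrt t)^-1).
Proof.
apply: (eq_measurable_fun (fun t : R => powR (Num.sqrt t) (-1))).
  by move=> t _; rewrite powR_inv1// sqrtr_ge0.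
apply: (measurableT_comp (measurable_powR _)).
exact: (continuous_measurable_fun (@sqrt_continuous R)).
Qed.

Section Substitution.
Context {R : realType}.
Local Notation mu := (@lebesgue_measure R).
Variables (a s : R) (k : R -> R).
Hypotheses (a0 : 0 <= a) (as_ : a < s).
Hypotheses (ck : continuous k) (k0 : forall t, 0 <= k t).

Let F (p : R) : R := Num.sqrt (p ^+ 2 - a ^+ 2).
Let f (p : R) : R := p / F p.

Let F_gt0 p : a < p -> 0 < F p.
Proof.
by move=> ap; rewrite sqrtr_gt0 subr_gt0 ltr_pXn2r// nnegrE (le_trans a0)// ltW.
Qed.

Let sqrF p : a <= p -> F p ^+ 2 = p ^+ 2 - a ^+ 2.
Proof.
by move=> ap; rewrite sqr_sqrtr// subr_ge0 ler_pXn2r// nnegrE (le_trans a0).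
Qed.

Let is_deriveF p : a < p -> is_derive p 1 F (f p).
Proof.
move=> ap; have Fp := F_gt0 ap.
have p2 : 0 < p ^+ 2 - a ^+ 2 by rewrite -sqrtr_gt0.
have h1 : is_derive p 1 (fun q : R => q ^+ 2 - a ^+ 2) (2 * p).
  apply: is_derive_eq; rewrite subr0 /GRing.scale/=; ring.
have h2 := is_derive1_sqrt p2.
apply: is_derive_eq.
rewrite /f /GRing.scale/= -/(F p); field; exact: lt0r_neq0.
Qed.

Let cF : continuous F.
Proof.
move=> p; apply: (@continuous_comp _ _ _ (fun p : R => p ^+ 2 - a ^+ 2) Num.sqrt).
  by apply: continuousB; [exact: exprn_continuous|exact: cst_continuous].
exact: sqrt_continuous.
Qed.

Let cf p : a < p -> {for p, continuous f}.
Proof.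
move=> ap; apply: continuousM; first exact: (@cvg_id _ (nbhs p)).
by apply: continuousV; [exact/lt0r_neq0/F_gt0|exact: cF].
Qed.

Let dFE p : a < p -> derive1 F p = f p.
Proof. by move=> ap; rewrite derive1E; have [_ ->] := is_deriveF ap. Qed.

Let cdF p : a < p -> {for p, continuous (derive1 F)}.
Proof.
move=> ap; rewrite /prop_for /continuous_at dFE//.
apply: cvg_trans (cf ap); apply: near_eq_cvg; near=> q.
by rewrite dFE//; near: q; exact: lt_nbhsr.
Unshelve. all: by end_near. Qed.

Let aj (j : nat) : R := a + (s - a) / j.+1%:R.

Let aj_gt j : a < aj j.
Proof. by rewrite ltrDl divr_gt0// subr_gt0. Qed.

Let aj_le j : aj j <= s.
Proof.
by rewrite -lerBrDl ger_pMr ?subr_gt0// invf_le1// ler1n.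
Qed.

Let aj_ni i j : (i <= j)%N -> aj j <= aj i.
Proof.
move=> ij; rewrite lerD2l ler_pM2l ?subr_gt0// lef_pV2 ?posrE// ler_nat.
by [].
Qed.

Let aj_lt p : a < p -> exists j, aj j <= p.
Proof.
move=> ap; have e0 : 0 < (p - a) / (s - a) by rewrite divr_gt0 ?subr_gt0.
have [N _ HN] := near_infty_natSinv_lt (PosNum e0).
exists N; have := HN N (leqnn N); rewrite /= ltr_pdivlMr ?subr_gt0// => h.
by rewrite -lerBrDl mulrC ltW.
Qed.

Let F_homo p q : a <= p -> p <= q -> F p <= F q.
Proof.
move=> ap pq; apply: ler_wsqrtr; rewrite lerD2r ler_pXn2r// nnegrE.
  exact: le_trans ap.
exact: le_trans (le_trans a0 ap) pq.
Qed.

Let subst_j j : (\int[mu]_(t in `[F (aj j), F s]) (k t)%:E =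
  \int[mu]_(p in `[aj j, s]) (k (F p) * f p)%:E)%E.
Proof.
rewrite integration_by_substitution_increasing//.
- apply: eq_integral => p; rewrite inE/= in_itv/= => /andP[jp _].
  by rewrite fctE/= dFE// (lt_le_trans (aj_gt j)).
- move=> p q; rewrite !in_itv/= => /andP[jp _] _ pq.
  have ap : a < p by exact: lt_le_trans jp.
  have aq := lt_trans ap pq.
  rewrite -(@ltr_pXn2r _ 2) ?nnegrE ?sqrtr_ge0// !sqrF ?ltW// ltrD2r.
  by rewrite ltr_pXn2r// nnegrE (le_trans a0)// ltW.
- move=> p; rewrite in_itv/= => /andP[jp _]; apply: cdF.
  exact: lt_trans jp.
- apply/cvg_ex; exists (derive1 F (aj j)).
  exact/cvg_at_right_filter/cdF.
- apply/cvg_ex; exists (derive1 F s).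
  exact/cvg_at_left_filter/cdF.
- split => [p||].
  + rewrite in_itv/= => /andP[jp _].
    by have [] := is_deriveF (lt_trans (aj_gt j) jp).
  + exact/cvg_at_right_filter/cF.
  + exact/cvg_at_left_filter/cF.
- exact: continuous_subspaceT.
Qed.

Let bigcupL : \bigcup_j `[F (aj j), F s]%classic = `]0, F s]%classic.
Proof.
apply/seteqP; split => t /=.
  move=> [j _] /=; rewrite !in_itv/= => /andP[jt ->]; rewrite andbT.
  by apply: lt_le_trans jt; exact: F_gt0.
rewrite in_itv/= => /andP[t0 ts].
pose p := Num.sqrt (t ^+ 2 + a ^+ 2).
have sp : p ^+ 2 = t ^+ 2 + a ^+ 2 by rewrite sqr_sqrtr// addr_ge0 ?sqr_ge0.
have ap : a < p.
  rewrite -(@ltr_pXn2r _ 2) ?nnegrE ?sqrtr_ge0// sp ltrDr exprn_gt0//.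
have [j jp] := aj_lt ap.
exists j => //=; rewrite in_itv/= ts andbT (_ : t = F p).
  by apply: F_homo => //; exact/ltW/aj_gt.
by rewrite /F sp addrK sqrtr_sqr gtr0_norm.
Qed.

Let bigcupR : \bigcup_j `[aj j, s]%classic = `]a, s]%classic.
Proof.
apply/seteqP; split => p /=.
  move=> [j _] /=; rewrite !in_itv/= => /andP[jt ->]; rewrite andbT.
  by apply: lt_le_trans jt; exact: aj_gt.
rewrite in_itv/= => /andP[/aj_lt[j jp] ps].
by exists j => //=; rewrite in_itv/= jp.
Qed.

(** The derivative of the substitution is unbounded at [p = a], where the
    square root vanishes; the formula is proved on [aj j <= p <= s] with [aj j]
    decreasing to [a], and passes to the limit by monotone convergence. *)
Lemma integral_subst_sqrt :
  (\int[mu]_(t in `]0%R, Num.sqrt (s ^+ 2 - a ^+ 2)[) (k t)%:E =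
   \int[mu]_(p in `]a, s[)
     (k (Num.sqrt (p ^+ 2 - a ^+ 2)) * (p / Num.sqrt (p ^+ 2 - a ^+ 2)))%:E)%E.
Proof.
have mk : measurable_fun setT k by exact: continuous_measurable_fun.
have mF : measurable_fun setT F by exact: continuous_measurable_fun.
pose h p := k (F p) * f p.
have mh : measurable_fun setT h.
  apply: measurable_funM; first exact: measurableT_comp.
  apply: measurable_funM => //.
  have mp : measurable_fun setT (fun p : R => p ^+ 2 - a ^+ 2).
    by apply: measurable_funB => //; exact: exprn_measurable.
  exact: (measurableT_comp (@measurable_sqrtV R) mp).
rewrite -[LHS](@integral_itv_bndoo _ _ _ _ false false); last first.
  exact/measurable_EFinP/measurable_funTS.
rewrite -[RHS](@integral_itv_bndoo _ _ _ _ false false); last first.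
  exact/measurable_EFinP/measurable_funTS.
rewrite -bigcupL -bigcupR.
have L : (\int[mu]_(t in `[F (aj j), F s]) (k t)%:E @[j --> \oo] -->
    \int[mu]_(t in \bigcup_j `[F (aj j), F s]%classic) (k t)%:E)%E.
  apply: ge0_nondecreasing_set_cvg_integral.
  - move=> i j ij; apply/subsetPset/subset_itvr; rewrite bnd_simp.
    by apply: F_homo; [exact/ltW/aj_gt|exact: aj_ni].
  - by move=> i; exact: measurable_itv.
  - by move=> i; exact/measurable_EFinP/measurable_funTS.
  - by move=> i t _; rewrite lee_fin.
have H : (\int[mu]_(t in `[aj j, s]) (h t)%:E @[j --> \oo] -->
    \int[mu]_(t in \bigcup_j `[aj j, s]%classic) (h t)%:E)%E.
  apply: ge0_nondecreasing_set_cvg_integral.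
  - move=> i j ij; apply/subsetPset/subset_itvr; rewrite bnd_simp.
    exact: aj_ni.
  - by move=> i; exact: measurable_itv.
  - by move=> i; exact/measurable_EFinP/measurable_funTS.
  - move=> i t; rewrite /= in_itv/= => /andP[it _]; rewrite lee_fin.
    rewrite mulr_ge0// divr_ge0// ?sqrtr_ge0//.
    by rewrite (le_trans a0)// (le_trans _ it)// ltW.
move: L; under eq_fun do rewrite subst_j; move=> L.
exact: (cvg_unique _ L H).
Qed.

End Substitution.

Section Polar.
Context {R : realType}.
Local Notation mu := (@lebesgue_measure R).
Local Notation leb := (@lebesgue_rV R).

(** Folding the line at [0] lets both hemispheres be treated at once. *)
Lemma ge0_integral_fold (F : R -> \bar R) : measurable_fun setT F ->
  (forall t, 0 <= F t)%E ->
  (\int[mu]_t F t = \int[mu]_(t in `]0%R, +oo[) (F t + F (- t)%R))%E.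
Proof.
move=> mF F0.
have mFN : measurable_fun setT (fun t : R => F (- t)%R).
  by apply: measurableT_comp => //; exact: oppr_measurable.
rewrite ge0_integralD//; last 2 first.
- exact: measurable_funTS.
- exact: measurable_funTS.
rewrite [X in (_ + X)%E](_ : _ = \int[mu]_(t in `]-oo, 0%R]) F t)%E; last first.
  rewrite integral_itv_obnd_cbnd; last exact: measurable_funTS.
  rewrite (ge0_integration_by_substitution0 mFN)//.
  by apply: eq_integral => t _; rewrite opprK.
rewrite -(setUv `]0%R, +oo[%classic) ge0_integral_setU//=; last 2 first.
- by rewrite setUv.
- exact/disj_setPCl.
  by rewrite setCitvr.
exact: measurableC.
Qed.

Lemma ge0_integral_fold_itv (g : R -> R) (H : R) :
  continuous g -> (forall t, 0 <= g t) ->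
  (\int[mu]_(t in `](- H)%R, H[) (g t)%:E =
   \int[mu]_(t in `]0%R, H[) (g t + g (- t))%:E)%E.
Proof.
move=> cg g0; rewrite integral_mkcond ge0_integral_fold; last 2 first.
- apply/(measurable_restrictT _ _).1 => //.
  apply/measurable_EFinP/measurable_funTS; exact: continuous_measurable_fun.
- by move=> t; apply: erestrict_ge0 => u _; rewrite lee_fin.
rewrite [LHS]integral_mkcond [RHS]integral_mkcond; apply: eq_integral => t _.
rewrite !patchE.
rewrite [in LHS](_ : (- t \in `](- H)%R, H[%classic) =
  (t \in `](- H)%R, H[%classic)); last first.
  by apply/idP/idP; rewrite !inE/= !in_itv/= -!ltr_norml normrN.
have memE (i : interval R) : (t \in [set` i]) = (t \in i).
  by apply/idP/idP => [/set_mem|/mem_set].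
rewrite !memE !in_itv/= andbT -ltr_norml.
have [t0|t0] := ltP 0 t; last by [].
by rewrite gtr0_norm//; case: ifP => //; rewrite adde0.
Qed.

(** The integrand, over the equatorial ball, of the integral of [f] over the
    sphere of radius [p] centred at the origin: both hemispheres, with their
    common area element. *)
Definition cap n (f : 'rV[R]_n.+1 -> R) (p : R) (v : 'rV[R]_n) : R :=
  (f (rV_cons (Num.sqrt (p ^+ 2 - enorm v ^+ 2)) v) +
   f (rV_cons (- Num.sqrt (p ^+ 2 - enorm v ^+ 2)) v)) *
  (p / Num.sqrt (p ^+ 2 - enorm v ^+ 2)).

Lemma measurable_cap n (f : 'rV[R]_n.+1 -> R) : continuous f ->
  measurable_fun setT
    (fun pv : measurableTypeR R * 'rV[R]_n => cap f pv.1 pv.2).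
Proof.
move=> cf.
have mf := continuous_measurable_rV cf.
have m1 : measurable_fun setT (fun pv : measurableTypeR R * 'rV[R]_n =>
    pv.1 ^+ 2 - enorm pv.2 ^+ 2 : measurableTypeR R).
  apply: measurable_funB.
    by apply: measurable_funX; exact: measurable_fst.
  apply: (measurableT_comp (continuous_measurable_rV (@continuous_sqr_enorm R n))).
  exact: measurable_snd.
have m2 : measurable_fun setT (fun pv : measurableTypeR R * 'rV[R]_n =>
    Num.sqrt (pv.1 ^+ 2 - enorm pv.2 ^+ 2) : measurableTypeR R).
  by apply: (measurableT_comp _ m1);
    exact: (continuous_measurable_fun (@sqrt_continuous R)).
have m3 (h : measurableTypeR R * 'rV[R]_n -> measurableTypeR R) :
    measurable_fun setT h ->
    measurable_fun setT (fun pv => f (rV_cons (h pv) pv.2)).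
  move=> mh; apply: (measurableT_comp mf).
  have mhv : measurable_fun setT
      (fun pv : measurableTypeR R * 'rV[R]_n => (h pv, pv.2)).
    by apply: measurable_fun_pair => //; exact: measurable_snd.
  exact: (measurableT_comp (@measurable_rV_cons R n) mhv).
apply: measurable_funM.
  apply: measurable_funD; apply: m3 => //.
  by apply: measurableT_comp => //; exact: oppr_measurable.
apply: measurable_funM; first exact: measurable_fst.
exact: (measurableT_comp (@measurable_sqrtV R) m1).
Qed.

(** Over a fixed point [v] of the equatorial plane, the substitution
    [t = sqrt (p ^+ 2 - |v| ^+ 2)] turns the height [t] into the radius [p];
    the integrals in [p] and [v] are then exchanged. *)
Lemma integral_ball_hemispheres n (f : 'rV[R]_n.+1 -> R) (s : R) :
  continuous f -> (forall y, 0 <= f y) -> 0 < s ->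
  (\int[leb n.+1]_(y in eball 0 s) (f y)%:E =
   \int[mu]_(p in `]0%R, s[) \int[leb n]_(v in eball 0 p) (cap f p v)%:E)%E.
Proof.
move=> cf f0 s0.
pose D : set (measurableTypeR R * 'rV[R]_n) :=
  [set pv | enorm pv.2 < pv.1 /\ pv.1 < s].
have mD : measurable D.
  have m1 : measurable_fun setT
      (fun pv : measurableTypeR R * 'rV[R]_n => enorm pv.2 < pv.1).
    apply: measurable_fun_ltr; last exact: measurable_fst.
    apply: (measurableT_comp (continuous_measurable_rV (@continuous_enorm R n))).
    exact: measurable_snd.
  have m2 : measurable_fun setT
      (fun pv : measurableTypeR R * 'rV[R]_n => pv.1 < s).
    by apply: measurable_fun_ltr; first exact: measurable_fst.
  rewrite (_ : D = (setT `&` (fun pv => enorm pv.2 < pv.1) @^-1` [set true])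
      `&` (setT `&` (fun pv => pv.1 < s) @^-1` [set true])).
    by apply: measurableI; [exact: m1|exact: m2].
  by rewrite !setTI; apply/seteqP; split => pv [].
pose Phi : measurableTypeR R * 'rV[R]_n -> \bar R :=
  (fun pv => (cap f pv.1 pv.2)%:E) \_ D.
have mPhi : measurable_fun setT Phi.
  apply/(measurable_restrictT _ mD); apply/measurable_EFinP.
  by apply: measurable_funTS; exact: measurable_cap.
have Phi0 pv : (0 <= Phi pv)%E.
  apply: erestrict_ge0 => -[p v] [/= vp _]; rewrite lee_fin /cap.
  by rewrite mulr_ge0 ?addr_ge0 ?divr_ge0 ?sqrtr_ge0//
    (le_trans (enorm_ge0 v))// ltW.
transitivity (\int[mu]_p \int[leb n]_v Phi (p, v))%E; last first.
  rewrite [RHS]integral_mkcond; apply: eq_integral => p _.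
  rewrite patchE; case: ifPn; rewrite ?inE ?notin_setE/= in_itv/=.
    move=> /andP[p0 ps]; rewrite [RHS]integral_mkcond; apply: eq_integral => v _.
    rewrite /Phi !patchE/= (_ : (p, v) \in D = (v \in eball 0 p))//.
    by apply/idP/idP; rewrite !inE /D /eball/= subr0 => // -[].
  move=> ps; apply: integral0_eq => v _;
    rewrite /Phi patchE memNset// => -[/= vp p_s].
  by apply: ps; rewrite p_s andbT (le_lt_trans (enorm_ge0 v)).
rewrite fubini_tonelli// integral_mkcond ge0_integral_rV_cons_swap; last 2 first.
- apply/(measurable_restrictT _ (measurable_eball 0 s)); apply/measurable_EFinP.
  by apply: measurable_funTS; exact: continuous_measurable_rV.
- by move=> y; apply: erestrict_ge0 => u _; rewrite lee_fin.
apply: eq_integral => v _.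
set h : R := Num.sqrt (s ^+ 2 - enorm v ^+ 2).
transitivity (\int[mu]_(t in `](- h)%R, h[) (f (rV_cons t v))%:E)%E.
  rewrite [RHS]integral_mkcond; apply: eq_integral => t _.
  rewrite !patchE /=.
  have E := eball_cons_height t v (ltW s0).
  by case: ifPn; case: ifPn;
    rewrite ?inE ?notin_setE -/h /= in_itv/= -ltr_norml => h1 h2 //; exfalso; tauto.
have cfv : continuous (fun t => f (rV_cons t v)).
  move=> t; apply: (@continuous_comp _ _ _ (fun t : R => rV_cons t v) f).
    exact: continuous_rV_consl.
  exact: cf.
rewrite ge0_integral_fold_itv//.
transitivity (\int[mu]_(p in `](enorm v), s[) (cap f p v)%:E)%E; last first.
  rewrite [LHS]integral_mkcond; apply: eq_integral => p _.
  rewrite /Phi !patchE/= (_ : (p, v) \in D = (p \in `](enorm v), s[%classic))//.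
  by apply/idP/idP; rewrite !inE /D /= in_itv/= => /andP.
have [vs|vs] := ltP (enorm v) s; last first.
  rewrite (@set_itv_ge _ _ (BRight (enorm v))) ?bnd_simp -?leNgt// integral_set0.
  have -> : h = 0.
    apply/eqP; rewrite sqrtr_eq0 subr_le0 ler_pXn2r// nnegrE ?enorm_ge0//.
    exact: ltW.
  by rewrite set_itv_ge ?integral_set0// bnd_simp ltxx.
rewrite (@integral_subst_sqrt _ _ _
  (fun t => f (rV_cons t v) + f (rV_cons (- t) v)))//.
- exact: enorm_ge0.
- move=> t; apply: continuousD; first exact: cfv.
  apply: (@continuous_comp _ _ _ (@GRing.opp R) (fun t => f (rV_cons t v))).
    exact: opp_continuous.
  exact: cfv.
- by move=> t; exact: addr_ge0.
Qed.

End Polar.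

(** * The derivative of a ball integral in the radius *)

Section SphereDerivative.
Context {R : realType}.
Local Notation mu := (@lebesgue_measure R).
Local Notation leb := (@lebesgue_rV R).

(** The function [cap] in the variable [w = v / p], which ranges over the unit
    ball whatever the radius. *)
Definition unit_cap n (f : 'rV[R]_n.+1 -> R) (p : R) (w : 'rV[R]_n) : R :=
  (f (p *: rV_cons (Num.sqrt (1 - enorm w ^+ 2)) w) +
   f (p *: rV_cons (- Num.sqrt (1 - enorm w ^+ 2)) w)) /
  Num.sqrt (1 - enorm w ^+ 2).

Lemma sqrt_scale n (p : R) (w : 'rV[R]_n) : 0 <= p ->
  Num.sqrt (p ^+ 2 - enorm (p *: w) ^+ 2) = p * Num.sqrt (1 - enorm w ^+ 2).
Proof.
move=> p0; rewrite enormZ ger0_norm// exprMn -{1}[p ^+ 2]mulr1 -mulrBr.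
by rewrite sqrtrM ?sqr_ge0// sqrtr_sqr ger0_norm.
Qed.

Lemma cap_scale n (f : 'rV[R]_n.+1 -> R) p w : 0 < p ->
  cap f p (p *: w) = unit_cap f p w.
Proof.
move=> p0; rewrite /cap sqrt_scale ?ltW// -(mulrN p) -!rV_consZ; congr (_ * _).
by rewrite invfM [LHS]mulrA divff ?lt0r_neq0// mul1r.
Qed.

Lemma cap_ge0 n (f : 'rV[R]_n.+1 -> R) p v : (forall y, 0 <= f y) -> 0 <= p ->
  0 <= cap f p v.
Proof. by move=> f0 p0; rewrite mulr_ge0 ?addr_ge0 ?divr_ge0 ?sqrtr_ge0. Qed.

Lemma unit_cap_ge0 n (f : 'rV[R]_n.+1 -> R) p v : (forall y, 0 <= f y) ->
  0 <= unit_cap f p v.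
Proof. by move=> f0; rewrite divr_ge0 ?addr_ge0 ?sqrtr_ge0. Qed.

Lemma measurable_cap_slice n (f : 'rV[R]_n.+1 -> R) p : continuous f ->
  measurable_fun setT (cap f p).
Proof.
by move=> cf; exact: (measurableT_comp (measurable_cap cf) (measurable_pair1 p)).
Qed.

Lemma measurable_unit_cap n (f : 'rV[R]_n.+1 -> R) p : continuous f ->
  measurable_fun setT (unit_cap f p).
Proof.
move=> cf.
have cfp : continuous (fun y : 'rV[R]_n.+1 => f (p *: y)).
  move=> y; apply: (@continuous_comp _ _ _ (fun y : 'rV[R]_n.+1 => p *: y) f).
    exact: scaler_continuous.
  exact: cf.
apply: (eq_measurable_fun (cap (fun y => f (p *: y)) 1)).
  by move=> w _; rewrite /cap /unit_cap expr1n mul1r.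
exact: measurable_cap_slice.
Qed.

Lemma integral_cap_scale n (f : 'rV[R]_n.+1 -> R) p :
  continuous f -> (forall y, 0 <= f y) -> 0 < p ->
  (\int[leb n]_(v in eball 0 p) (cap f p v)%:E =
   (p ^+ n)%:E * \int[leb n]_(w in eball 0 1) (unit_cap f p w)%:E)%E.
Proof.
move=> cf f0 p0; rewrite integral_mkcond [in RHS]integral_mkcond.
rewrite -(@ge0_integral_affine _ _ 0 p)//; last 2 first.
- apply/(measurable_restrictT _ (measurable_eball 0 p)); apply/measurable_EFinP.
  by apply: measurable_funTS; exact: measurable_cap_slice.
- by move=> y; apply: erestrict_ge0 => u _; rewrite lee_fin cap_ge0// ltW.
congr (_ * _)%E; apply: eq_integral => w _; rewrite !patchE add0r cap_scale//.
rewrite (_ : (p *: w \in eball 0 p) = (w \in eball 0 1))//.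
have := eball_scale 0 1 w p0; rewrite add0r mulr1 => pw.
by apply/idP/idP => /set_mem h; apply/mem_set; [rewrite -pw|rewrite pw].
Qed.

Definition unit_kernel n (w : 'rV[R]_n) : R := (Num.sqrt (1 - enorm w ^+ 2))^-1.

Lemma unit_kernel_ge0 n (w : 'rV[R]_n) : 0 <= unit_kernel w.
Proof. by rewrite invr_ge0 sqrtr_ge0. Qed.

(** If the integral were infinite, so would be the integral of a constant over
    every sphere, hence the volume of the unit ball. *)
Lemma integrable_unit_kernel n :
    (leb n).-integrable (eball 0 1) (EFin \o @unit_kernel n).
Proof.
(* The constant [2^-1] makes the two hemispheres add up to [unit_kernel]. *)
have c1 : continuous (fun _ : 'rV[R]_n.+1 => 2^-1 : R).
  by move=> y; exact: (@cst_continuous _ _ _ y).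
have uk w p : unit_cap (fun _ : 'rV[R]_n.+1 => 2^-1 : R) p w = unit_kernel w.
  by rewrite /unit_cap /unit_kernel (_ : 2^-1 + 2^-1 = 1) ?mul1r//; lra.
have muk : measurable_fun setT (@unit_kernel n).
  apply: eq_measurable_fun (measurable_unit_cap 1 c1) => w _; exact: uk.
apply/integrableP; split; first exact/measurable_EFinP/measurable_funTS.
under eq_integral do rewrite /= ger0_norm ?unit_kernel_ge0//.
have := lebesgue_eball_fin (0 : 'rV[R]_n.+1) 1.
set K := (X in _ -> (X < _)%E).
apply: contraTT; rewrite -!leNgt !leye_eq => /eqP Koo.
have h0 (y : 'rV[R]_n.+1) : 0 <= 2^-1 :> R by [].
have := integral_ball_hemispheres c1 h0 ltr01.
rewrite integral_cst; last exact: measurable_eball.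
rewrite [X in _ = X -> _](_ : _ = \int[mu]_(p in `]0%R, 1%R[) +oo)%E; last first.
  apply: eq_integral => p; rewrite inE/= in_itv/= => /andP[p0 p1].
  rewrite integral_cap_scale//.
  under eq_integral do rewrite uk.
  by rewrite -/K Koo gt0_muley// lte_fin exprn_gt0.
have -> : (\int[mu]_(p in `]0%R, 1%R[) +oo = +oo)%E.
  rewrite integral_cst//.
  rewrite (_ : _ `]_, _[%classic = mu `]0%R, 1%R[%classic)//.
  by rewrite lebesgue_measure_itv/= lte_fin ltr01 oppr0 adde0 mule1.
move=> h; rewrite -leye_eq leNgt; apply/negP => Lfin.
have Lf : leb n.+1 (eball 0 1) \is a fin_num by rewrite ge0_fin_numE.
by move/(congr1 (fun z => z \is a fin_num)): h; rewrite fin_numM.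
Qed.

Lemma enorm_cap n (p : R) (w : 'rV[R]_n) (e : R) : 0 <= p -> e ^+ 2 = 1 ->
  eball 0 1 w ->
  enorm (p *: rV_cons (e * Num.sqrt (1 - enorm w ^+ 2)) w) = p.
Proof.
move=> p0 e1 /eball0E; rewrite expr1n => /(_ ler01) w1.
rewrite enormZ ger0_norm// -[RHS]mulr1; congr (_ * _); apply/eqP.
rewrite -(@eqrXn2 _ 2) ?enorm_ge0// sqr_enorm_cons exprMn e1 mul1r expr1n.
by rewrite sqr_sqrtr ?subr_ge0 ?ltW// subrK.
Qed.

Lemma unit_cap_bound n (f : 'rV[R]_n.+1 -> R) (B : R) : continuous f ->
  exists2 M, 0 <= M & forall p w, 0 < p < B -> eball 0 1 w ->
    `|unit_cap f p w| <= M * unit_kernel w.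
Proof.
move=> cf; have [M fM] := bounded_eball 0 B cf.
exists (2 * `|M|) => [|p w /andP[p0 pB] w1]; first by rewrite mulr_ge0.
rewrite /unit_cap -/(unit_kernel w) normrM (ger0_norm (unit_kernel_ge0 w)).
apply: ler_wpM2r; first exact: unit_kernel_ge0.
have fb e : e ^+ 2 = 1 ->
    `|f (p *: rV_cons (e * Num.sqrt (1 - enorm w ^+ 2)) w)| <= `|M|.
  move=> e1; apply: le_trans (ler_norm M); apply: fM.
  by rewrite /eball/= subr0 enorm_cap// ltW.
apply: le_trans (ler_normD _ _) _; rewrite mulrDl mul1r lerD//.
  by have := fb 1; rewrite mul1r; apply; rewrite expr1n.
by have := fb (-1); rewrite mulN1r; apply; rewrite sqrrN expr1n.
Qed.

Lemma integrable_unit_cap n (f : 'rV[R]_n.+1 -> R) (p : R) :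
    continuous f -> 0 < p ->
  (leb n).-integrable (eball 0 1) (EFin \o unit_cap f p).
Proof.
move=> cf p0; have [M M0 fM] := unit_cap_bound (p + 1) cf.
have iM : (leb n).-integrable (eball 0 1) (EFin \o (fun w => M * @unit_kernel n w)).
  rewrite (_ : _ \o _ = (fun w => M%:E * (EFin \o @unit_kernel n) w)%E)//.
  by apply: integrableZl; [exact: measurable_eball|exact: integrable_unit_kernel].
apply: le_integrable iM.
- exact: measurable_eball.
- by apply/measurable_EFinP/measurable_funTS; exact: measurable_unit_cap.
- move=> w w1; rewrite /= lee_fin [leRHS]ger0_norm ?mulr_ge0 ?unit_kernel_ge0//.
  by apply: fM => //; rewrite p0/= ltrDl ltr01.
Qed.

Lemma continuous_unit_cap n (f : 'rV[R]_n.+1 -> R) (w : 'rV[R]_n) :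
  continuous f -> continuous (fun p : R => unit_cap f p w).
Proof.
move=> cf.
have cfp (z : 'rV[R]_n.+1) : continuous (fun p : R => f (p *: z)).
  move=> p; apply: (@continuous_comp _ _ _ (fun p : R => p *: z) f).
    exact: scalel_continuous.
  exact: cf.
pose A (p : R) := f (p *: rV_cons (Num.sqrt (1 - enorm w ^+ 2)) w) +
    f (p *: rV_cons (- Num.sqrt (1 - enorm w ^+ 2)) w).
have cA : continuous A by move=> p; apply: continuousD; exact: cfp.
move=> p; have h := @continuousM _ _ A (fun=> unit_kernel w) p (cA p)
  (@cst_continuous _ _ _ p).
exact: h.
Qed.

Definition scaled_sphere_integral n (f : 'rV[R]_n.+1 -> R) (p : R) : R :=
  p ^+ n * \int[leb n]_(w in eball 0 1) unit_cap f p w.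

(** On bounded sets of radii the integrands are dominated by a multiple of
    [unit_kernel]. *)
Lemma continuous_scaled_sphere_integral n (f : 'rV[R]_n.+1 -> R) (r : R) :
    continuous f -> 0 < r ->
  {for r, continuous (scaled_sphere_integral f)}.
Proof.
move=> cf r0; apply: continuousM; first exact: exprn_continuous.
have [M M0 fM] := unit_cap_bound (r + 1) cf.
have iM : (leb n).-integrable (eball 0 1) (EFin \o (fun w => M * @unit_kernel n w)).
  rewrite (_ : _ \o _ = (fun w => M%:E * (EFin \o @unit_kernel n) w)%E)//.
  by apply: integrableZl; [exact: measurable_eball|exact: integrable_unit_kernel].
have := @continuity_under_integral R _ _ (leb n) (unit_cap f) (eball 0 1)
  (measurable_eball 0 1) 0 (r + 1) _ _ _ iM; apply.
- by move=> p /=; rewrite in_itv/= => /andP[p0 _]; exact: integrable_unit_cap.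
- by apply: aeW => w w1 p _; exact: continuous_unit_cap.
- move=> p /=; rewrite in_itv/= => pB; apply: aeW => w w1.
  exact: fM.
- by rewrite inE/= in_itv/= r0/= ltrDl ltr01.
Qed.

Lemma integral_ball_spheres n (f : 'rV[R]_n.+1 -> R) (s : R) :
  continuous f -> (forall y, 0 <= f y) -> 0 < s ->
  (\int[leb n.+1]_(y in eball 0 s) (f y)%:E =
   \int[mu]_(p in `]0%R, s[) (scaled_sphere_integral f p)%:E)%E.
Proof.
move=> cf f0 s0; rewrite integral_ball_hemispheres//; apply: eq_integral => p.
rewrite inE/= in_itv/= => /andP[p0 _]; rewrite integral_cap_scale//.
rewrite /scaled_sphere_integral EFinM fineK//; apply: integrable_fin_num;
  last exact: integrable_unit_cap.
exact: measurable_eball.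
Qed.

Lemma is_derive_ball_ge0 n (f : 'rV[R]_n.+1 -> R) (r : R) :
  continuous f -> (forall y, 0 <= f y) -> 0 < r ->
  is_derive r 1 (fun s => \int[leb n.+1]_(y in eball 0 s) f y)
    (scaled_sphere_integral f r).
Proof.
move=> cf f0 r0.
have ms : measurable_fun (`]0, +oo[%classic : set R) (scaled_sphere_integral f).
  apply: open_continuous_measurable_fun; first exact: interval_open.
  by move=> p; rewrite inE/= in_itv/= andbT;
    exact: continuous_scaled_sphere_integral.
have msb b (s : R) : measurable_fun
    ([set` Interval (BRight 0) (BSide b s)] : set R) (scaled_sphere_integral f).
  by apply: measurable_funS ms => //; exact: subset_itvl.
have E s : 0 < s -> \int[mu]_(p in `]0, s]) scaled_sphere_integral f p =
    \int[leb n.+1]_(y in eball 0 s) f y.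
  move=> s0; rewrite /Rintegral integral_ball_spheres//; congr fine.
  rewrite integral_itv_bndo_bndc//; apply/measurable_EFinP; exact: (msb true s).
have ints : mu.-integrable `]0, r + 1] (EFin \o scaled_sphere_integral f).
  apply/integrableP; split; first by apply/measurable_EFinP; exact: (msb false).
  have r10 : 0 < r + 1 by rewrite addr_gt0.
  under eq_integral => p.
    rewrite inE/= in_itv/= => /andP[p0 _].
    rewrite ger0_norm; last first.
      apply: mulr_ge0; first exact/exprn_ge0/ltW.
      by apply: Rintegral_ge0 => w _; exact: unit_cap_ge0.
    over.
  rewrite -integral_itv_bndo_bndc; last by apply/measurable_EFinP;
    exact: (msb true).
  rewrite -integral_ball_spheres//.
  exact: (integrable_lty (measurable_eball 0 (r + 1))
    (integrable_eball 0 (r + 1) cf)).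
have rr : r < r + 1 by rewrite ltrDl.
have br : (BRight 0 < BRight r)%O by rewrite bnd_simp.
have [dF FE] := continuous_FTC1 rr ints br
  (continuous_scaled_sphere_integral cf r0).
apply: (@near_eq_is_derive _ _ _
  (fun x : R => \int[mu]_(t in `]0, x]) scaled_sphere_integral f t)).
  near=> s; apply: E; near: s; exact: lt_nbhsr.
by split; [exact: dF|rewrite -derive1E; exact: FE].
Unshelve. all: by end_near. Qed.

End SphereDerivative.

Section SphereIntegral.
Context {R : realType}.
Local Notation mu := (@lebesgue_measure R).
Local Notation leb := (@lebesgue_rV R).

Lemma is_derive_line (V W : normedModType R) (f : V -> W) (x v : V) (d : W) :
  is_derive (0 : R) (1 : R) (fun t : R => f (t *: v + x)) d -> is_derive x v f d.
Proof.
case=> df dE; have dv : derivable f x v by exact/derivable1P.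
apply: (DeriveDef dv).
rewrite -dE /derive.
set g1 := fun h => h^-1 *: _; set g2 := fun h => h^-1 *: _.
suff -> : g1 = g2 by [].
rewrite funeqE /g1 /g2 => h /=.
by rewrite addr0 scale0r add0r [_%:A]mulr1.
Qed.

Lemma sqr_enorm_line n (v : 'rV[R]_n) (i : 'I_n) (t : R) :
  enorm (t *: ebasis i + v) ^+ 2 = enorm v ^+ 2 + 2 * v 0 i * t + t ^+ 2.
Proof.
rewrite !sqr_enorm (bigD1 i)//= [in RHS](bigD1 i)//=.
rewrite (eq_bigr (fun j => v 0 j ^+ 2)) => [|j ji]; last first.
  by rewrite !mxE eqxx (negbTE ji)/= mulr0 add0r.
by rewrite !mxE !eqxx/=; ring.
Qed.

Lemma is_derive_height n (p : R) (v : 'rV[R]_n) (i : 'I_n) : 0 < p ->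
  eball 0 p v ->
  is_derive v (ebasis i) (fun u => Num.sqrt (p ^+ 2 - enorm u ^+ 2))
    (- (Num.sqrt (p ^+ 2 - enorm v ^+ 2))^-1 * v 0 i).
Proof.
move=> p0 /(eball0E _ (ltW p0)) vp; apply: is_derive_line.
under eq_fun do rewrite sqr_enorm_line.
set c := enorm v ^+ 2; set b := v 0 i.
have q0 : 0 < (fun t : R => p ^+ 2 - (c + 2 * b * t + t ^+ 2)) 0.
  by rewrite mulr0 expr0n/= !addr0 subr_gt0.
have h1 : is_derive (0 : R) 1
    (fun t : R => p ^+ 2 - (c + 2 * b * t + t ^+ 2)) (- (2 * b)).
  by apply: is_derive_eq; rewrite /GRing.scale/=; ring.
have h2 := is_derive1_sqrt q0.
apply: is_derive_eq.
rewrite /GRing.scale/= mulr0 expr0n/= !addr0; field.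
by rewrite lt0r_neq0// sqrtr_gt0 subr_gt0.
Qed.

(** With [h = sqrt (p^2 - |v|^2)], the gradient of [e h] at [v] is
    [- e v / h], so [1 + |grad|^2 = (h^2 + |v|^2) / h^2 = p^2 / h^2]. The sign
    [e] is [1] on the upper hemisphere and [-1] on the lower one. *)
Lemma hemisphere_area_element n (p : R) (e : R) (v : 'rV[R]_n) :
    0 < p -> e ^+ 2 = 1 ->
  eball 0 p v ->
  Num.sqrt (1 + enorm (gradE (fun u : 'rV[R]_n =>
    e * Num.sqrt (p ^+ 2 - enorm u ^+ 2)) v) ^+ 2) =
  p / Num.sqrt (p ^+ 2 - enorm v ^+ 2).
Proof.
move=> p0 e1 pv; have /(eball0E _ (ltW p0)) vp := pv.
set h : R := Num.sqrt (p ^+ 2 - enorm v ^+ 2).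
have h0 : 0 < h by rewrite sqrtr_gt0 subr_gt0.
have h2 : h ^+ 2 = p ^+ 2 - enorm v ^+ 2 by rewrite sqr_sqrtr// subr_ge0 ltW.
have -> : gradE (fun u : 'rV[R]_n => e * Num.sqrt (p ^+ 2 - enorm u ^+ 2)) v =
    (- e * h^-1) *: v.
  apply/rowP => i; rewrite !mxE.
  have [dh dhE] := is_derive_height i p0 pv.
  rewrite (deriveZ e dh) dhE /GRing.scale/= -/h; ring.
rewrite enormZ exprMn real_normK ?num_real// exprMn sqrrN e1 mul1r.
have -> : 1 + h^-1 ^+ 2 * enorm v ^+ 2 = (p / h) ^+ 2.
  rewrite exprMn (_ : p ^+ 2 = h ^+ 2 + enorm v ^+ 2); last by rewrite h2 subrK.
  by field; exact: lt0r_neq0.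
by rewrite sqrtr_sqr gtr0_norm// divr_gt0.
Qed.

Let hemi n (e : R) (f : 'rV[R]_n.+1 -> R) p v : R :=
  f (rV_cons (e * Num.sqrt (p ^+ 2 - enorm v ^+ 2)) v) *
  (p / Num.sqrt (p ^+ 2 - enorm v ^+ 2)).

Let graph_integralE n (f : 'rV[R]_n.+1 -> R) p e h : 0 < p -> e ^+ 2 = 1 ->
  (forall v, h v = e * Num.sqrt (p ^+ 2 - enorm v ^+ 2)) ->
  graph_integral (eball 0 p) h f = \int[leb n]_(v in eball 0 p) hemi e f p v.
Proof.
move=> p0 e1 hE; apply: eq_Rintegral => v; rewrite inE => vp.
by rewrite (funext hE) hemisphere_area_element.
Qed.

Let measurable_hemi n (f : 'rV[R]_n.+1 -> R) p e : continuous f ->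
  measurable_fun setT (@hemi n e f p).
Proof.
move=> cf.
have m1 : measurable_fun setT (fun v : 'rV[R]_n => p ^+ 2 - enorm v ^+ 2).
  apply: measurable_funB => //.
  exact: (continuous_measurable_rV (@continuous_sqr_enorm R n)).
have m2 : measurable_fun setT (fun v : 'rV[R]_n =>
    e * Num.sqrt (p ^+ 2 - enorm v ^+ 2) : measurableTypeR R).
  apply: measurable_funM => //.
  exact: (measurableT_comp
    (continuous_measurable_fun (@sqrt_continuous R)) m1).
have m3 : measurable_fun setT
    (fun v : 'rV[R]_n => (e * Num.sqrt (p ^+ 2 - enorm v ^+ 2), v)).
  by apply: measurable_fun_pair.
apply: measurable_funM; last first.
  by apply: measurable_funM => //;
    exact: (measurableT_comp (@measurable_sqrtV R) m1).
apply: (measurableT_comp (continuous_measurable_rV cf)).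
exact: (measurableT_comp (@measurable_rV_cons R n) m3).
Qed.

Let integrable_hemi_ge0 n (f : 'rV[R]_n.+1 -> R) p e : 0 < p ->
  (e = 1) \/ (e = -1) -> continuous f -> (forall y, 0 <= f y) ->
  (leb n).-integrable (eball 0 p) (EFin \o hemi e f p).
Proof.
move=> p0 e1 cf f0.
have icap : (leb n).-integrable (eball 0 p) (EFin \o cap f p).
  apply/integrableP; split.
    by apply/measurable_EFinP/measurable_funTS; exact: measurable_cap_slice.
  under eq_integral do rewrite /= ger0_norm ?cap_ge0 ?ltW//.
  rewrite integral_cap_scale// lte_mul_pinfty//.
    by rewrite lee_fin exprn_ge0// ltW.
  exact: (integrable_lty (measurable_eball 0 1) (integrable_unit_cap cf p0)).
apply: le_integrable icap.
- exact: measurable_eball.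
- by apply/measurable_EFinP/measurable_funTS; exact: measurable_hemi.
move=> v pv; rewrite /= lee_fin [leRHS]ger0_norm; last first.
  by apply: cap_ge0 => //; exact: ltW.
rewrite ger0_norm; last first.
  by apply: mulr_ge0 => //; apply: divr_ge0; [exact: ltW|exact: sqrtr_ge0].
rewrite /hemi /cap; apply: ler_wpM2r; first by
  apply: divr_ge0; [exact: ltW|exact: sqrtr_ge0].
by case: e1 => ->; rewrite ?mul1r ?mulN1r ?lerDl ?lerDr.
Qed.

(** The decomposition of [f] as [`|f| - (`|f| - f)] reduces statements about
    integrals of continuous functions to nonnegative continuous ones. *)
Lemma continuous_norm_fun n (f : 'rV[R]_n -> R) : continuous f ->
  continuous (fun y => `|f y|).
Proof.
move=> cf y; apply: (@continuous_comp _ _ _ f (@Num.norm R R)); first exact: cf.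
exact: norm_continuous.
Qed.

Lemma continuous_normB n (f : 'rV[R]_n -> R) : continuous f ->
  continuous (fun y => `|f y| - f y).
Proof.
by move=> cf y; exact: (cvgB (continuous_norm_fun cf (x := y)) (cf y)).
Qed.

Lemma normB_ge0 n (f : 'rV[R]_n -> R) y : 0 <= `|f y| - f y.
Proof. by rewrite subr_ge0 ler_norm. Qed.

Let integrable_hemi n (f : 'rV[R]_n.+1 -> R) p e : 0 < p ->
  (e = 1) \/ (e = -1) -> continuous f ->
  (leb n).-integrable (eball 0 p) (EFin \o hemi e f p).
Proof.
move=> p0 e1 cf; pose fp y := `|f y|; pose fn y := `|f y| - f y.
rewrite (_ : _ \o _ = (EFin \o hemi e fp p) \- (EFin \o hemi e fn p))%E;
  last first.
  by apply/funext => v /=; rewrite -EFinB /hemi -mulrBl /fp /fn subKr.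
apply: integrableB; first exact: measurable_eball.
  apply: integrable_hemi_ge0 => //; first exact: (continuous_norm_fun cf).
  by move=> y; exact: normr_ge0.
apply: integrable_hemi_ge0 => //; first exact: (continuous_normB cf).
exact: normB_ge0.
Qed.

Lemma sphere_integralE n (f : 'rV[R]_n.+1 -> R) p : continuous f -> 0 < p ->
  sphere_integral 0 p f = \int[leb n]_(v in eball 0 p) cap f p v.
Proof.
move=> cf p0; rewrite /sphere_integral.
have f0 : (fun z => f (0 + z)) = f by apply/funext => z; rewrite add0r.
rewrite f0.
have s1 : (-1 : R) ^+ 2 = 1 by rewrite sqrrN expr1n.
rewrite (graph_integralE f p0 (expr1n _ 2)); last by move=> v; rewrite mul1r.
rewrite (graph_integralE f p0 s1); last by move=> v; rewrite mulN1r.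
rewrite -RintegralD.
- by apply: eq_Rintegral => v _; rewrite /hemi /cap mul1r mulN1r -mulrDl.
- exact: measurable_eball.
- by apply: integrable_hemi => //; left.
- by apply: integrable_hemi => //; right.
Qed.

Lemma integrable_cap n (f : 'rV[R]_n.+1 -> R) p : continuous f -> 0 < p ->
  (leb n).-integrable (eball 0 p) (EFin \o cap f p).
Proof.
move=> cf p0.
rewrite (_ : _ \o _ = (EFin \o hemi 1 f p) \+ (EFin \o hemi (-1) f p))%E;
  last first.
  by apply/funext => v /=; rewrite -EFinD /hemi /cap mul1r mulN1r -mulrDl.
apply: integrableD; first exact: measurable_eball.
  by apply: integrable_hemi => //; left.
by apply: integrable_hemi => //; right.
Qed.

(** The derivative at the centre [0]; linearity of the sphere integral in [f]
    comes from that of the integrals of [cap]. *)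
Lemma is_derive_ball n (f : 'rV[R]_n.+1 -> R) (r : R) : continuous f -> 0 < r ->
  is_derive r 1 (fun s => \int[leb n.+1]_(y in eball 0 s) f y)
    (sphere_integral 0 r f).
Proof.
move=> cf r0.
have cfp := continuous_norm_fun cf; have cfn := continuous_normB cf.
have sphE (h : 'rV[R]_n.+1 -> R) : continuous h -> (forall y, 0 <= h y) ->
    scaled_sphere_integral h r = \int[leb n]_(v in eball 0 r) cap h r v.
  move=> ch h0; rewrite /scaled_sphere_integral /Rintegral integral_cap_scale//.
  rewrite fineM//; apply: integrable_fin_num; last exact: integrable_unit_cap.
  exact: measurable_eball.
have dp := is_derive_ball_ge0 cfp (fun y => normr_ge0 (f y)) r0.
have dn := is_derive_ball_ge0 cfn (normB_ge0 f) r0.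
pose Ip s := \int[leb n.+1]_(y in eball 0 s) `|f y|.
pose In s := \int[leb n.+1]_(y in eball 0 s) (`|f y| - f y).
rewrite (_ : (fun s : R => _) = Ip \- In); last first.
  apply/funext => s /=; rewrite -RintegralB; last 3 first.
  - exact: measurable_eball.
  - exact: integrable_eball.
  - exact: integrable_eball.
  by apply: eq_Rintegral => y _; rewrite subKr.
have dB : is_derive r 1 (Ip \- In)
    (scaled_sphere_integral (fun y => `|f y|) r -
     scaled_sphere_integral (fun y => `|f y| - f y) r).
  exact: is_deriveB.
rewrite (_ : sphere_integral 0 r f =
  scaled_sphere_integral (fun y => `|f y|) r -
  scaled_sphere_integral (fun y => `|f y| - f y) r)//.
rewrite sphere_integralE// (sphE _ cfp (fun y => normr_ge0 (f y))).
rewrite (sphE _ cfn (normB_ge0 f)).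
rewrite -RintegralB; last 3 first.
- exact: measurable_eball.
- exact: integrable_cap.
- exact: integrable_cap.
apply: eq_Rintegral => v _; rewrite /cap -mulrBl; congr (_ * _).
by rewrite opprD addrACA !subKr.
Qed.

End SphereIntegral.

Section Divergence.
Context {R : realType}.
Local Notation mu := (@lebesgue_measure R).
Local Notation leb := (@lebesgue_rV R).

Lemma continuous_translate n (x : 'rV[R]_n) (f : 'rV[R]_n -> R) :
  continuous f -> continuous (fun z => f (x + z)).
Proof.
move=> cf z; apply: (@continuous_comp _ _ _ (fun z : 'rV[R]_n => x + z) f).
  exact: (cvgD (@cst_continuous _ _ x z) (@cvg_id _ (nbhs (z : 'rV[R]_n)))).
exact: cf.
Qed.

Let translate_ge0 n (x : 'rV[R]_n) (s : R) (f : 'rV[R]_n -> R) : continuous f ->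
  (forall y, 0 <= f y) ->
  \int[leb n]_(y in eball x s) f y = \int[leb n]_(z in eball 0 s) f (x + z).
Proof.
move=> cf f0; congr fine; rewrite integral_mkcond [RHS]integral_mkcond.
rewrite -(@ge0_integral_affine _ _ x 1)//; last 2 first.
- apply/(measurable_restrictT _ (measurable_eball x s)); apply/measurable_EFinP.
  by apply: measurable_funTS; exact: continuous_measurable_rV.
- by move=> y; apply: erestrict_ge0 => u _; rewrite lee_fin.
rewrite expr1n mul1e; apply: eq_integral => z _; rewrite !patchE scale1r.
rewrite (_ : (x + z \in eball x s) = (z \in eball 0 s))//.
have := eball_scale x s z ltr01; rewrite mul1r scale1r => E.
by apply/idP/idP => /set_mem h; apply/mem_set; [rewrite -E|rewrite E].
Qed.

Lemma Rintegral_eball_translate n (x : 'rV[R]_n) (s : R) (f : 'rV[R]_n -> R) :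
  continuous f ->
  \int[leb n]_(y in eball x s) f y = \int[leb n]_(z in eball 0 s) f (x + z).
Proof.
move=> cf; have c1 := continuous_norm_fun cf; have c2 := continuous_normB cf.
have E D g : (\int[leb n]_(y in D) g y : R) =
    \int[leb n]_(y in D) (`|g y| - (`|g y| - g y)).
  by apply: eq_Rintegral => y _; rewrite subKr.
have cx := @continuous_translate _ x _ cf.
rewrite E [RHS]E [LHS]RintegralB; last first.
all: try exact: measurable_eball.
all: try exact: integrable_eball.
all: try exact: (@integrable_eball _ _ _ _ _ (continuous_norm_fun cx)).
all: try exact: (@integrable_eball _ _ _ _ _ (continuous_normB cx)).
rewrite [RHS]RintegralB; last first.
all: try exact: measurable_eball.
all: try exact: (@integrable_eball _ _ _ _ _ (continuous_norm_fun cx)).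
all: try exact: (@integrable_eball _ _ _ _ _ (continuous_normB cx)).
have T1 : \int[leb n]_(y in eball x s) `|f y| =
    \int[leb n]_(z in eball 0 s) `|f (x + z)|.
  exact: (@translate_ge0 _ x s _ c1).
have T2 : \int[leb n]_(y in eball x s) (`|f y| - f y) =
    \int[leb n]_(z in eball 0 s) (`|f (x + z)| - f (x + z)).
  by apply: (@translate_ge0 _ x s _ c2) => y; exact: normB_ge0.
by rewrite T1 T2.
Qed.

Lemma sphere_integral_center n (x : 'rV[R]_n.+1) (r : R) f :
  sphere_integral x r f = sphere_integral 0 r (fun z => f (x + z)).
Proof.
rewrite /sphere_integral (_ : (fun z => f (x + (0 + z))) = (fun z => f (x + z)))//.
by apply/funext => z; rewrite add0r.
Qed.

Lemma is_derive_eball n (x : 'rV[R]_n.+1) (f : 'rV[R]_n.+1 -> R) (r : R) :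
  continuous f -> 0 < r ->
  is_derive r 1 (fun s => \int[leb n.+1]_(y in eball x s) f y)
    (sphere_integral x r f).
Proof.
move=> cf r0; rewrite sphere_integral_center.
rewrite (_ : (fun s : R => _) =
    (fun s => \int[leb n.+1]_(y in eball 0 s) f (x + y))); last first.
  by apply/funext => s; exact: Rintegral_eball_translate.
exact/is_derive_ball/r0/continuous_translate.
Qed.

Lemma is_derive_unique (f : R -> R) (r a b : R) :
  is_derive r 1 f a -> is_derive r 1 f b -> a = b.
Proof. by move=> [_ <-] [_ <-]. Qed.

Lemma eq_sphere_integral n (r : R) (f g : 'rV[R]_n.+1 -> R) : 0 < r ->
  (forall y, enorm y = r -> f y = g y) ->
  sphere_integral 0 r f = sphere_integral 0 r g.
Proof.
move=> r0 fg.
have E e v : e ^+ 2 = 1 -> eball 0 r v ->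
    enorm (rV_cons (e * Num.sqrt (r ^+ 2 - enorm (v : 'rV[R]_n) ^+ 2)) v) = r.
  move=> e1 /eball0E vr; have := vr (ltW r0) => {}vr.
  apply/eqP; rewrite -(@eqrXn2 _ 2) ?enorm_ge0 ?ltW// sqr_enorm_cons exprMn e1.
  by rewrite mul1r sqr_sqrtr ?subrK// subr_ge0 ltW.
congr (_ + _); apply: eq_Rintegral => v; rewrite inE => vr; congr (_ * _).
  by rewrite !add0r; apply: fg; have := E 1 v; rewrite mul1r expr1n; apply.
rewrite !add0r; apply: fg; have := E (-1) v.
by rewrite mulN1r sqrrN expr1n; apply.
Qed.

(** Ball integrals are linear and sphere integrals are their derivatives. *)
Lemma sphere_integralZ n (r k : R) (f : 'rV[R]_n.+1 -> R) : 0 < r ->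
  continuous f ->
  sphere_integral 0 r (fun y => k * f y) = k * sphere_integral 0 r f.
Proof.
move=> r0 cf.
have ck : continuous (fun y => k * f y).
  by move=> y; exact: (cvgM (@cst_continuous _ _ k y) (cf y)).
have dk := is_derive_ball ck r0; have df := is_derive_ball cf r0.
apply: is_derive_unique dk _.
rewrite (_ : (fun s : R => _) =
    k \*: (fun s : R => \int[leb n.+1]_(y in eball 0 s) f y)).
  exact: is_deriveZ.
apply/funext => s /=; rewrite RintegralZl//.
  exact: measurable_eball.
exact: integrable_eball.
Qed.

End Divergence.

(** * The divergence theorem on balls *)

Section DivergenceTheorem.
Context {R : realType}.
Local Notation mu := (@lebesgue_measure R).
Local Notation leb := (@lebesgue_rV R).

Lemma is_derive_sqr_enorm n (v : 'rV[R]_n) (i : 'I_n) :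
  is_derive v (ebasis i) (fun u => enorm u ^+ 2) (2 * v 0 i).
Proof.
apply: is_derive_line; under eq_fun do rewrite sqr_enorm_line.
apply: is_derive_eq; rewrite /GRing.scale/=; ring.
Qed.

Lemma continuous_coord n (i : 'I_n) : continuous (fun v : 'rV[R]_n => v 0 i).
Proof. exact: coord_continuous. Qed.

Lemma continuous_sum_fun (T : topologicalType) (I : finType) (f : I -> T -> R) :
  (forall i, continuous (f i)) -> continuous (fun y => \sum_i f i y).
Proof.
by move=> cf; apply: continuous_big => [|i _ v]; [exact: add_continuous|exact: cf].
Qed.

Lemma continuous_mul (T : topologicalType) (f g : T -> R) :
  continuous f -> continuous g -> continuous (fun y => f y * g y).
Proof. by move=> cf cg y; exact: (cvgM (cf y) (cg y)). Qed.

Lemma continuous_sub (T : topologicalType) (f g : T -> R) :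
  continuous f -> continuous g -> continuous (fun y => f y - g y).
Proof. by move=> cf cg y; exact: (cvgB (cf y) (cg y)). Qed.

Lemma continuous_fun_cst (T : topologicalType) (k : R) :
  continuous (fun _ : T => k).
Proof. by move=> y; exact: (@cst_continuous _ _ k y). Qed.

Lemma Rintegral_eball_sum n (I : Type) (r : seq I) (x : 'rV[R]_n) (s : R)
    (f : I -> 'rV[R]_n -> R) : (forall i, continuous (f i)) ->
  \int[leb n]_(y in eball x s) (\sum_(i <- r) f i y) =
  \sum_(i <- r) \int[leb n]_(y in eball x s) f i y.
Proof.
move=> cf; have mB := measurable_eball x s.
elim: r => [|i r IHr].
  under eq_Rintegral do rewrite big_nil.
  by rewrite big_nil Rintegral_cst// mul0r.
rewrite big_cons -IHr -RintegralD//; last 2 first.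
- exact: integrable_eball.
- apply: integrable_eball; apply: continuous_big => [|j _];
  first exact: add_continuous.
  exact: cf.
by apply: eq_Rintegral => y _; rewrite big_cons.
Qed.

Variables (n : nat) (X : 'I_n.+1 -> 'rV[R]_n.+1 -> R).
Hypothesis cX : forall i, continuous (X i).
Hypothesis dX : forall i y, derivable (X i) y (ebasis i).
Hypothesis cdX : forall i, continuous ('D_(ebasis i) (X i)).

Let div y := \sum_i 'D_(ebasis i) (X i) y.
Let flux (y : 'rV[R]_n.+1) := \sum_i y 0 i * X i y.

Let cdiv : continuous div.
Proof. by apply: continuous_sum_fun => i; exact: cdX. Qed.

Let cflux : continuous flux.
Proof.
by apply: continuous_sum_fun => i; apply: continuous_mul;
  [exact: continuous_coord|exact: cX].
Qed.

Let weighted s i : 0 < s ->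
  \int[leb n.+1]_(y in eball 0 s)
    ((s ^+ 2 - enorm y ^+ 2) * 'D_(ebasis i) (X i) y - 2 * (y 0 i * X i y)) = 0.
Proof.
move=> s0; pose F y := (s ^+ 2 - enorm y ^+ 2) * X i y.
have DF y : is_derive y (ebasis i) F
    ((s ^+ 2 - enorm y ^+ 2) * 'D_(ebasis i) (X i) y - 2 * (y 0 i * X i y)).
  have h1 := is_derive_sqr_enorm y i.
  have h2 : is_derive y (ebasis i) (X i) ('D_(ebasis i) (X i) y).
    exact/derivableP/dX.
  have h3 : is_derive y (ebasis i) (fun y => s ^+ 2 - enorm y ^+ 2) (- (2 * y 0 i)).
    by apply: is_derive_eq; rewrite sub0r.
  by apply: (is_derive_eq (is_deriveM h3 h2)); rewrite /GRing.scale/=; ring.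
rewrite /Rintegral [X in fine X](_ : _ = 0%E)//.
rewrite -(@integral_derive_eball _ _ i s F)//; last 3 first.
- exact: ltW.
- rewrite (_ : 'D__ _ = fun y => (s ^+ 2 - enorm y ^+ 2) * 'D_(ebasis i) (X i) y -
      2 * (y 0 i * X i y)); last first.
    by apply/funext => y; have [_ ->] := DF y.
  apply: continuous_sub; apply: continuous_mul.
  + apply: continuous_sub; first exact: continuous_fun_cst.
    exact: continuous_sqr_enorm.
  + exact: cdX.
  + exact: continuous_fun_cst.
  + by apply: continuous_mul; [exact: continuous_coord|exact: cX].
- by move=> y ys; rewrite /F ys subrr mul0r.
by apply: eq_integral => y _; have [_ ->] := DF y.
Qed.

Let crad : continuous (fun y => enorm y ^+ 2 * div y).
Proof. by apply: continuous_mul; [exact: continuous_sqr_enorm|exact: cdiv]. Qed.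

(** The integral over the ball of the divergence of [(s ^+ 2 - |y| ^+ 2) X],
    which vanishes on the sphere. *)
Let balance s : 0 < s ->
  s ^+ 2 * \int[leb n.+1]_(y in eball 0 s) div y -
  \int[leb n.+1]_(y in eball 0 s) (enorm y ^+ 2 * div y) =
  2 * \int[leb n.+1]_(y in eball 0 s) flux y.
Proof.
move=> s0.
have mB := measurable_eball (0 : 'rV[R]_n.+1) s.
have iB (f : 'rV[R]_n.+1 -> R) : continuous f ->
    (leb n.+1).-integrable (eball 0 s) (EFin \o f).
  by move=> cf; exact: integrable_eball.
rewrite -RintegralZl//; last exact: iB.
rewrite -RintegralZl//; last exact: iB.
have c1 : continuous (fun y => s ^+ 2 * div y).
  by apply: continuous_mul; [exact: continuous_fun_cst|exact: cdiv].
have c2 : continuous (fun y => 2 * flux y).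
  by apply: continuous_mul; [exact: continuous_fun_cst|exact: cflux].
rewrite -(RintegralB mB (iB _ c1) (iB _ crad)).
apply/eqP; rewrite -subr_eq0 -(RintegralB mB _ (iB _ c2)); last first.
  by apply: (iB (fun y => _ - _)); exact: continuous_sub.
pose w i y := (s ^+ 2 - enorm y ^+ 2) * 'D_(ebasis i) (X i) y - 2 * (y 0 i * X i y).
have cw i : continuous (w i).
  apply: continuous_sub; apply: continuous_mul => //.
  + apply: continuous_sub; first exact: continuous_fun_cst.
    exact: continuous_sqr_enorm.
  + exact: continuous_fun_cst.
  + by apply: continuous_mul; [exact: continuous_coord|exact: cX].
rewrite (_ : Rintegral _ _ _ = \int[leb n.+1]_(y in eball 0 s) \sum_i w i y).
  by rewrite Rintegral_eball_sum// big1// => i _; exact: weighted.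
apply: eq_Rintegral => y _; rewrite sumrB -!mulr_sumr -/(div y) -/(flux y).
by rewrite mulrBl.
Qed.

(** Both sides of [balance] are differentiated at [r]. On the sphere of radius
    [r] the functions [|y| ^+ 2 * div y] and [r ^+ 2 * div y] agree, so their
    sphere integrals cancel. *)
Lemma divergence_eball r : 0 < r ->
  r * \int[leb n.+1]_(y in eball 0 r) \sum_i 'D_(ebasis i) (X i) y =
  sphere_integral 0 r (fun y => \sum_i y 0 i * X i y).
Proof.
move=> r0; rewrite -/div -/flux.
have dd := is_derive_ball cdiv r0.
have dr := is_derive_ball crad r0.
have df := is_derive_ball cflux r0.
pose L s := s ^+ 2 * \int[leb n.+1]_(y in eball 0 s) div y -
  \int[leb n.+1]_(y in eball 0 s) (enorm y ^+ 2 * div y).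
have dL : is_derive r 1 L (2 * r * \int[leb n.+1]_(y in eball 0 r) div y).
  have d2 : is_derive r 1 (fun s : R => s ^+ 2) (2 * r).
    by apply: is_derive_eq; rewrite /GRing.scale/=; ring.
  apply: (is_derive_eq (is_deriveB (is_deriveM d2 dd) dr)).
  rewrite (@eq_sphere_integral _ _ _ (fun y => enorm y ^+ 2 * div y)
    (fun y => r ^+ 2 * div y) r0); last first.
    by move=> y /= ->.
  by rewrite (sphere_integralZ _ r0 cdiv) /GRing.scale/=; ring.
have dL' : is_derive r 1 L (2 * sphere_integral 0 r flux).
  apply: (@near_eq_is_derive _ _ _
      (fun s : R => 2 * \int[leb n.+1]_(y in eball 0 s) flux y)).
    near=> s; rewrite /L balance//; near: s; exact: lt_nbhsr.
have := is_derive_unique dL dL'.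
rewrite -mulrA => /mulfI; apply; lra.
Unshelve. all: by end_near. Qed.

End DivergenceTheorem.

(** * The Pohozaev identity for conserved tensors *)

Lemma is_derive_translate (R : realType) (V W : normedModType R) (f : V -> W)
    (x z v : V) (d : W) :
  is_derive (x + z) v f d -> is_derive z v (fun y => f (x + y)) d.
Proof.
case=> df dE.
have E : (fun h : R => h^-1 *: (f (x + (h *: v + z)) - f (x + z))) =
    (fun h : R => h^-1 *: (f (h *: v + (x + z)) - f (x + z))).
  by apply/funext => h; rewrite addrCA.
split; first by rewrite /derivable/= E.
by rewrite -dE /derive/= E.
Qed.

Lemma is_derive_coord (R : realType) n (z : 'rV[R]_n) (j k : 'I_n) :
  is_derive z (ebasis j) (fun y : 'rV[R]_n => y 0 k) (j == k)%:R.
Proof.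
apply: is_derive_line.
have -> : (fun t : R => (t *: ebasis j + z) 0 k) = fun t => t * (j == k)%:R + z 0 k.
  by apply/funext => t; rewrite !mxE eqxx eq_sym.
by apply: is_derive_eq; rewrite /GRing.scale/=; ring.
Qed.

(** The tensor [T] stands for the pulled back metric and [W] for the potential
    along the map; [conservation] says that [e delta - T] is divergence
    free. *)
Section Pohozaev.
Context {R : realType} {n : nat}.
Local Notation leb := (@lebesgue_rV R).
Local Notation N := n.+1.
Variables (T : 'I_N -> 'I_N -> 'rV[R]_N -> R) (W : 'rV[R]_N -> R).

Let e y := 2^-1 * (\sum_j T j j y) - W y.

Hypothesis cT : forall j k, continuous (T j k).
Hypothesis cW : continuous W.
Hypothesis dT : forall j k l y, derivable (T j k) y (ebasis l).
Hypothesis dW : forall l y, derivable W y (ebasis l).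
Hypothesis cdT : forall j k l, continuous ('D_(ebasis l) (T j k)).
Hypothesis cdW : forall l, continuous ('D_(ebasis l) W).
Hypothesis conservation : forall k y,
  \sum_j 'D_(ebasis j) (T j k) y =
  2^-1 * \sum_j 'D_(ebasis k) (T j j) y - 'D_(ebasis k) W y.

Let ce : continuous e.
Proof.
apply: continuous_sub => //; apply: continuous_mul; first exact: continuous_fun_cst.
by apply: continuous_sum_fun => j.
Qed.

Let de k y : is_derive y (ebasis k) e
  (2^-1 * \sum_j 'D_(ebasis k) (T j j) y - 'D_(ebasis k) W y).
Proof.
have d1 : is_derive y (ebasis k) (\sum_j T j j) (\sum_j 'D_(ebasis k) (T j j) y).
  apply: is_derive_sum => j; exact/derivableP/dT.
have d2 := is_deriveZ 2^-1 d1.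
have d3 : is_derive y (ebasis k) W ('D_(ebasis k) W y) by exact/derivableP/dW.
have -> : e = (2^-1 \*: (\sum_j T j j)) - W.
  by apply/funext => z; rewrite /e /= !fctE fct_sumE.
exact: is_deriveB.
Qed.

(** The position field contracted with the stress-energy tensor, in the
    coordinate [z = y - x]. *)
Let X (x : 'rV[R]_N) (j : 'I_N) (z : 'rV[R]_N) : R :=
  \sum_k ((j == k)%:R * e (x + z) - T j k (x + z)) * z 0 k.

Let DX x j z : is_derive z (ebasis j) (X x j)
  (\sum_k (((j == k)%:R * (2^-1 * \sum_l 'D_(ebasis j) (T l l) (x + z) -
    'D_(ebasis j) W (x + z)) - 'D_(ebasis j) (T j k) (x + z)) * z 0 k) +
   (e (x + z) - T j j (x + z))).
Proof.
pose S (k : 'I_N) (y : 'rV[R]_N) : R := (j == k)%:R * e (x + y) - T j k (x + y).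
pose DS (k : 'I_N) : R :=
  (j == k)%:R * (2^-1 * \sum_l 'D_(ebasis j) (T l l) (x + z) -
    'D_(ebasis j) W (x + z)) - 'D_(ebasis j) (T j k) (x + z).
have dS (k : 'I_N) : is_derive z (ebasis j) (S k) (DS k).
  have d1 := is_derive_translate (de j (x + z)).
  have d2 := is_derive_translate (derivableP (@dT j k j (x + z))).
  exact: (is_deriveB (is_deriveZ (j == k)%:R d1) d2).
have -> : X x j = \sum_k (S k * (fun y : 'rV[R]_N => y 0 k)).
  by apply/funext => y; rewrite fct_sumE.
have dM (k : 'I_N) : is_derive z (ebasis j) (S k * (fun y : 'rV[R]_N => y 0 k))
    (S k z * (j == k)%:R + z 0 k * DS k).
  exact: (is_deriveM (dS k) (is_derive_coord z j k)).
apply: (is_derive_eq (is_derive_sum dM)).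
rewrite big_split/= addrC; congr (_ + _).
  by apply: eq_bigr => k _; rewrite mulrC.
rewrite (bigD1 j)//= eqxx mulr1 big1 ?addr0 => [|k kj].
  by rewrite /S eqxx mul1r.
by rewrite eq_sym (negPf kj) mulr0.
Qed.

Let X_div x z : \sum_j 'D_(ebasis j) (X x j) z =
  (N%:R - 2) * e (x + z) - 2 * W (x + z).
Proof.
under eq_bigr do rewrite (@derive_val _ _ _ _ _ _ _ (DX x _ z)).
rewrite big_split/= exchange_big/= big1 ?add0r; last first.
  move=> k _; rewrite -mulr_suml sumrB conservation (bigD1 k)//= eqxx mul1r.
  rewrite [X in (_ + X - _) * _]big1 ?addr0 ?subrr ?mul0r// => j /negPf jk.
  by rewrite jk mul0r.
rewrite sumrB sumr_const card_ord -mulr_natl.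
have -> : \sum_j T j j (x + z) = 2 * (e (x + z) + W (x + z)).
  by rewrite /e subrK mulrA divff// mul1r.
by ring.
Qed.

Lemma sphere_integralB (r : R) (f h : 'rV[R]_N -> R) : 0 < r ->
  continuous f -> continuous h ->
  sphere_integral 0 r (fun y => f y - h y) =
  sphere_integral 0 r f - sphere_integral 0 r h.
Proof.
move=> r0 cf ch.
have df := is_derive_ball cf r0; have dh := is_derive_ball ch r0.
have dfh := is_derive_ball (continuous_sub cf ch) r0.
apply: is_derive_unique dfh _.
have -> : (fun s : R => \int[leb N]_(y in eball 0 s) (f y - h y)) =
    (fun s : R => \int[leb N]_(y in eball 0 s) f y) \-
    (fun s : R => \int[leb N]_(y in eball 0 s) h y).
  apply/funext => s /=; rewrite RintegralB//.
  - exact: measurable_eball.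
  - exact: integrable_eball.
  - exact: integrable_eball.
exact: is_deriveB.
Qed.

Let A (x : 'rV[R]_N) r := \int[leb N]_(y in eball x r) e y.
Let Q x y := \sum_j \sum_k radial x y 0 j * radial x y 0 k * T j k y.

(** The divergence theorem for [X]: on the sphere, [z . X] is [r ^+ 2] times
    [e - Q]. Since [Q x] is not continuous at [x], it is replaced there by the
    continuous function [r ^- 2 * B], equal to it on the sphere. *)
Lemma pohozaev_identity (x : 'rV[R]_N) (r : R) : 0 < r ->
  (N%:R - 2) * A x r - 2 * \int[leb N]_(y in eball x r) W y =
  r * (sphere_integral x r e - sphere_integral x r (Q x)).
Proof.
move=> r0.
have cex := continuous_translate (x := x) ce.
have cWx := continuous_translate (x := x) cW.
have cTx j k := continuous_translate (x := x) (@cT j k).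
have cX j : continuous (X x j).
  apply: continuous_sum_fun => k; apply: continuous_mul;
    last exact: continuous_coord.
  apply: continuous_sub; last exact: cTx.
  by apply: continuous_mul; [exact: continuous_fun_cst|exact: cex].
have dX j z : derivable (X x j) z (ebasis j) by have [] := DX x j z.
have cdX j : continuous ('D_(ebasis j) (X x j)).
  rewrite (funext (fun z => @derive_val _ _ _ _ _ _ _ (DX x j z))).
  have cdWx := continuous_translate (x := x) (@cdW j).
  have cdTx i k := continuous_translate (x := x) (@cdT i k j).
  have cadd (f h : 'rV[R]_N -> R) : continuous f -> continuous h ->
      continuous (fun y => f y + h y).
    by move=> cf ch y; exact: (cvgD (cf y) (ch y)).
  apply: cadd; last exact: continuous_sub.
  apply: continuous_sum_fun => k; apply: continuous_mul;
    last exact: continuous_coord.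
  apply: continuous_sub; last exact: cdTx.
  apply: continuous_mul; first exact: continuous_fun_cst.
  apply: continuous_sub; last exact: cdWx.
  apply: continuous_mul; first exact: continuous_fun_cst.
  by apply: continuous_sum_fun => l; exact: cdTx.
have := divergence_eball cX dX cdX r0.
under eq_Rintegral do rewrite X_div.
pose B (z : 'rV[R]_N) : R := \sum_j \sum_k z 0 j * z 0 k * T j k (x + z).
have cB : continuous B.
  apply: continuous_sum_fun => j; apply: continuous_sum_fun => k.
  apply: continuous_mul; last exact: cTx.
  by apply: continuous_mul; exact: continuous_coord.
have ceB : continuous (fun z => r ^+ 2 * e (x + z)).
  by apply: continuous_mul; [exact: continuous_fun_cst|exact: cex].
rewrite (@eq_sphere_integral _ _ _ _ (fun z => r ^+ 2 * e (x + z) - B z) r0);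
  last first.
  move=> z zr; rewrite -zr sqr_enorm mulr_suml -sumrB; apply: eq_bigr => j _.
  rewrite /X mulr_sumr.
  under eq_bigr do rewrite mulrBl mulrBr.
  rewrite sumrB; congr (_ - _).
    rewrite (bigD1 j)//= eqxx mul1r big1 ?addr0 => [|k kj]; first by ring.
    by rewrite eq_sym (negPf kj) !mul0r mulr0.
  by apply: eq_bigr => k _; rewrite mulrCA mulrC.
rewrite sphere_integralB// sphere_integralZ//.
have -> : sphere_integral 0 r B = r ^+ 2 * sphere_integral x r (Q x).
  have cB' : continuous (fun z => r ^- 2 * B z).
    by apply: continuous_mul; [exact: continuous_fun_cst|exact: cB].
  have -> : sphere_integral x r (Q x) = sphere_integral 0 r (fun z => r ^- 2 * B z).
    rewrite sphere_integral_center; apply: eq_sphere_integral => // z zr.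
    rewrite /Q /B mulr_sumr; apply: eq_bigr => j _.
    rewrite mulr_sumr; apply: eq_bigr => k _.
    have -> : radial x (x + z) = r^-1 *: z by rewrite /radial addrAC subrr add0r zr.
    by rewrite !mxE; field; exact: lt0r_neq0.
  rewrite sphere_integralZ// mulrA divff ?mul1r//.
  by rewrite expf_neq0// lt0r_neq0.
rewrite RintegralB; last 3 first.
- exact: measurable_eball.
- by apply: (@integrable_eball _ _ _ _ (fun z => _ * e (x + z)));
  apply: continuous_mul; [exact: continuous_fun_cst|exact: cex].
- by apply: (@integrable_eball _ _ _ _ (fun z => _ * W (x + z)));
  apply: continuous_mul; [exact: continuous_fun_cst|exact: cWx].
rewrite RintegralZl; last 2 first.
- exact: measurable_eball.
- exact: integrable_eball.
rewrite RintegralZl; last 2 first.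
- exact: measurable_eball.
- exact: integrable_eball.
rewrite -!Rintegral_eball_translate// -sphere_integral_center -/(A x r) => H.
apply: (@mulfI _ r); first exact: lt0r_neq0.
by rewrite H; ring.
Qed.

Lemma pohozaev (x : 'rV[R]_N) (r : R) : 0 < r ->
  is_derive r 1 (fun s : R => s ^ (2%:Z - N%:Z) * A x s)
    (r ^ (2%:Z - N%:Z) * sphere_integral x r (Q x)
     - 2 * r ^ (1 - N%:Z) * \int[leb N]_(y in eball x r) W y).
Proof.
move=> r0.
have dA := is_derive_eball x ce r0.
have powE s (k : nat) : 0 < s -> s ^ (k%:Z - N%:Z) = s ^+ k * (s ^+ N)^-1 :> R.
  by move=> s0; rewrite expfzDr ?lt0r_neq0// exprz_inv -exprnN.
have dp : is_derive r 1 (fun s : R => s ^+ 2 * (s ^+ N)^-1)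
    ((2 - N%:R) * (r * (r ^+ N)^-1)).
  have rN0 : r ^+ N != 0 by rewrite expf_neq0// lt0r_neq0.
  have h1 : is_derive r 1 (fun s : R => s ^+ 2) (2 * r).
    by apply: is_derive_eq; rewrite /GRing.scale/=; ring.
  have h2 : is_derive r 1 (fun s : R => s ^+ N) (N%:R * r ^+ n).
    split; first exact: exprn_derivable.
    by rewrite exp_derive /GRing.scale/= mulr1.
  have h3 := @is_deriveV R (fun s : R => s ^+ N) r _ 1 rN0 h2.
  apply: (is_derive_eq (is_deriveM h1 h3)).
  rewrite /GRing.scale/= [in r ^+ N]exprS; field.
  by rewrite expf_neq0 ?lt0r_neq0.
apply: (@near_eq_is_derive _ _ _ (fun s : R => s ^+ 2 * (s ^+ N)^-1 * A x s)).
  near=> s; rewrite powE//; near: s; exact: lt_nbhsr.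
apply: (is_derive_eq (is_deriveM dp dA)).
have := pohozaev_identity x r0.
rewrite powE// -(expr1z r) (powE r 1%N r0) expr1.
set a := A x r; set w := \int[_]_(y in _) W y.
set se := sphere_integral x r e; set sq := sphere_integral x r (Q x).
move=> H; rewrite /GRing.scale/=.
have -> : r ^+ 2 * (r ^+ N)^-1 * se + a * ((2 - N%:R) * (r * (r ^+ N)^-1)) =
  (r * (r ^+ N)^-1) * (r * (se - sq) - (N%:R - 2) * a) +
  r ^+ 2 * (r ^+ N)^-1 * sq by ring.
by rewrite -H; ring.
Unshelve. all: by end_near. Qed.

End Pohozaev.

(** * Symmetry of second derivatives *)

Section Schwarz.
Context {R : realType} {V : normedModType R}.
Implicit Types (f : V -> R) (x v w : V).

Lemma derive_line f x v (t : R) :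
  derivable f (t *: v + x) v ->
  is_derive t (1 : R) (fun s : R => f (s *: v + x)) ('D_v f (t *: v + x)).
Proof.
move=> df.
have E : (fun h : R => h^-1 *: ((fun s : R => f (s *: v + x)) (h *: (1 : R) + t) -
       (fun s : R => f (s *: v + x)) t)) =
    (fun h => h^-1 *: (f (h *: v + (t *: v + x)) - f (t *: v + x))).
  apply/funext => h; congr (_ *: (f _ - _)).
  by rewrite addrA -scalerDl /GRing.scale/= mulr1.
split; first by rewrite /derivable E.
by rewrite /derive E.
Qed.

(** Two applications of the mean value theorem, first along [v], then along
    [w]. *)
Lemma second_difference f x v w (h : R) : 0 < h ->
  (forall s t, 0 <= s <= h -> 0 <= t <= h ->
    derivable f (s *: v + (t *: w + x)) v /\
    derivable ('D_v f) (s *: v + (t *: w + x)) w) ->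
  exists s t, [/\ 0 <= s <= h, 0 <= t <= h &
    f (h *: v + (h *: w + x)) - f (h *: v + x) - (f (h *: w + x) - f x) =
    'D_w ('D_v f) (s *: v + (t *: w + x)) * h * h].
Proof.
move=> h0 df.
have h0r : 0 <= (0 : R) <= h by rewrite lexx ltW.
have hhr : 0 <= h <= h by rewrite lexx ltW.
have ooW (t : R) : t \in `]0, h[ -> 0 <= t <= h.
  by rewrite in_itv/= => /andP[t0 th]; rewrite !ltW.
have swap s t : s *: v + (t *: w + x) = t *: w + (s *: v + x).
  by rewrite addrCA.
pose G (s : R) := f (s *: v + (h *: w + x)) - f (s *: v + x).
have dG s : 0 <= s <= h -> is_derive s (1 : R) G
    ('D_v f (s *: v + (h *: w + x)) - 'D_v f (s *: v + x)).
  move=> sh; have [d1 _] := df s h sh hhr; have [d0 _] := df s 0 sh h0r.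
  rewrite scale0r add0r in d0.
  exact: (is_deriveB (derive_line d1) (derive_line d0)).
have [|s sh] := @MVT_segment R G _ 0 h (ltW h0) (fun s sh => dG s (ooW s sh)).
  apply: derivable_within_continuous => t; rewrite in_itv/= => th.
  by have [] := dG t th.
rewrite in_itv/= in sh; rewrite {1 2}/G scale0r !add0r subr0 => Es.
pose K (t : R) := 'D_v f (t *: w + (s *: v + x)).
have dK t : 0 <= t <= h ->
    is_derive t (1 : R) K ('D_w ('D_v f) (t *: w + (s *: v + x))).
  move=> th; apply: derive_line; rewrite -swap.
  by have [] := df s t sh th.
have [|t th] := @MVT_segment R K _ 0 h (ltW h0) (fun s sh => dK s (ooW s sh)).
  apply: derivable_within_continuous => t; rewrite in_itv/= => th.
  by have [] := dK t th.
rewrite in_itv/= in th; rewrite {1 2}/K scale0r add0r subr0 -!swap => Et.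
by exists s, t; split=> //; rewrite Es Et.
Qed.

Lemma nbhs_square (A : set V) x v w : nbhs x A ->
  exists2 h : R, 0 < h &
    forall s t, 0 <= s <= h -> 0 <= t <= h -> A (s *: v + (t *: w + x)).
Proof.
move=> /nbhs_normP[e /= e0 eA].
have d0 : 0 < `|v| + `|w| + 1 by rewrite ltr_wpDl ?addr_ge0.
exists (e / (`|v| + `|w| + 1)); first exact: divr_gt0.
move=> s t /andP[s0 sh] /andP[t0 th]; apply: eA => /=.
rewrite addrA opprD addrCA subrr addr0 normrN.
apply: (@le_lt_trans _ _ (e / (`|v| + `|w| + 1) * (`|v| + `|w|))).
  rewrite (le_trans (ler_normD _ _))// !normrZ !ger0_norm// mulrDr lerD//.
    exact: ler_wpM2r.
  exact: ler_wpM2r.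
by rewrite -mulrA gtr_pMr// ltr_pdivrMl// mulr1 ltrDl.
Qed.

(** Both second derivatives, at suitable points of a small square with corner
    [x], are equal to one and the same second difference quotient. *)
Lemma mixed_derivatives f x v w :
  (\forall y \near x, [/\ derivable f y v, derivable f y w,
     derivable ('D_v f) y w & derivable ('D_w f) y v]) ->
  {for x, continuous ('D_w ('D_v f))} -> {for x, continuous ('D_v ('D_w f))} ->
  'D_w ('D_v f) x = 'D_v ('D_w f) x.
Proof.
move=> df cwv cvw; apply/eqP; rewrite -subr_eq0 -normr_le0.
apply/ler_addgt0Pl => e e0; rewrite addr0.
have e20 : 0 < e / 2 by rewrite divr_gt0.
have nwv : \forall y \near x, `|'D_w ('D_v f) x - 'D_w ('D_v f) y| < e / 2.
  exact: ((cvgrPdist_lt _ _).1 cwv).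
have nvw : \forall y \near x, `|'D_v ('D_w f) x - 'D_v ('D_w f) y| < e / 2.
  exact: ((cvgrPdist_lt _ _).1 cvw).
have [h h0 H] := nbhs_square v w (filterI df (filterI nwv nvw)).
have swap s t : s *: v + (t *: w + x) = t *: w + (s *: v + x).
  by rewrite addrCA.
have hvw a b : 0 <= a <= h -> 0 <= b <= h ->
    derivable f (a *: v + (b *: w + x)) v /\
    derivable ('D_v f) (a *: v + (b *: w + x)) w.
  by move=> ah bh; have [[]] := H a b ah bh.
have hwv a b : 0 <= a <= h -> 0 <= b <= h ->
    derivable f (a *: w + (b *: v + x)) w /\
    derivable ('D_w f) (a *: w + (b *: v + x)) v.
  by move=> ah bh; rewrite -swap; have [[]] := H b a bh ah.
have [s [t [sh th E]]] := second_difference h0 hvw.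
have [t' [s' [th' sh' E']]] := second_difference h0 hwv.
have [_ [Hwv _]] := H s t sh th; have [_ [_ Hvw]] := H s' t' sh' th'.
have EE : 'D_w ('D_v f) (s *: v + (t *: w + x)) =
    'D_v ('D_w f) (s' *: v + (t' *: w + x)).
  apply: (@mulIf _ h); first exact: lt0r_neq0.
  apply: (@mulIf _ h); first exact: lt0r_neq0.
  rewrite (swap s' t'); apply: etrans (esym E) _; apply: etrans _ E'.
  rewrite (swap h h).
  move: (f (h *: w + _)) (f (h *: v + x)) (f (h *: w + x)) (f x) => a b c d.
  by ring.
move: Hwv Hvw; rewrite EE.
move: ('D_w ('D_v f) x) ('D_v ('D_w f) x) ('D_v ('D_w f) (s' *: v + _)).
move=> a b c ac bc; rewrite -(subrKA c) (le_trans (ler_normD _ _))//.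
by rewrite [leRHS]splitr lerD ?ltW// distrC.
Qed.

End Schwarz.

(** * Continuously differentiable functions and the chain rule *)

Section Calculus.
Context {R : realType}.

(** On an open set this is equivalent to being of class C^1. It is phrased with
    partial derivatives because these, being limits of difference quotients,
    transport at once along an equality of functions near a point. *)
Definition C1_on n (U : set 'rV[R]_n) (f : 'rV[R]_n -> R) : Prop :=
  forall y, U y -> {for y, continuous f} /\
    forall l, derivable f y (ebasis l) /\ {for y, continuous ('D_(ebasis l) f)}.

Lemma near_open (T : topologicalType) (U : set T) (y : T) (P : T -> Prop) :
  open U -> U y -> (forall z, U z -> P z) -> \forall z \near y, P z.
Proof. by move=> oU Uy UP; apply: filterS UP _; exact: open_nbhs_nbhs. Qed.

Lemma near_eq_continuous (T S : topologicalType) (f g : T -> S) (y : T) :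
  (\forall z \near y, f z = g z) -> {for y, continuous f} ->
  {for y, continuous g}.
Proof.
move=> fg cf; rewrite /prop_for /continuous_at -(nbhs_singleton fg).
exact: cvg_trans (near_eq_cvg fg) cf.
Qed.

Lemma eq_C1_on n (U : set 'rV[R]_n) (f g : 'rV[R]_n -> R) : open U ->
  (forall y, U y -> f y = g y) -> C1_on U f -> C1_on U g.
Proof.
move=> oU fg Cf y Uy; have [cf df] := Cf y Uy.
have nfg z : U z -> \forall t \near z, f t = g t by move=> Uz; exact: near_open fg.
split; first exact: near_eq_continuous (nfg y Uy) cf.
move=> l; have [dl cl] := df l; split; first exact: near_eq_derivable (nfg y Uy) dl.
apply: near_eq_continuous cl; apply: near_open oU Uy _ => z Uz.
exact: near_eq_derive (nfg z Uz).
Qed.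

Lemma C1_onM n (U : set 'rV[R]_n) (f g : 'rV[R]_n -> R) : open U ->
  C1_on U f -> C1_on U g -> C1_on U (fun y => f y * g y).
Proof.
move=> oU Cf Cg y Uy; have [cf df] := Cf y Uy; have [cg dg] := Cg y Uy.
split; first exact: (cvgM cf cg).
move=> l; have [dfl cfl] := df l; have [dgl cgl] := dg l.
split; first exact: derivableM.
apply: (@near_eq_continuous _ _
  (fun z => f z * 'D_(ebasis l) g z + g z * 'D_(ebasis l) f z)); last first.
  exact: (cvgD (cvgM cf cgl) (cvgM cg cfl)).
apply: near_open oU Uy _ => z Uz.
have [_ dfz] := Cf z Uz; have [_ dgz] := Cg z Uz.
have [dfzl _] := dfz l; have [dgzl _] := dgz l.
by rewrite (deriveM dfzl dgzl).
Qed.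

Lemma C1_onD n (U : set 'rV[R]_n) (f g : 'rV[R]_n -> R) : open U ->
  C1_on U f -> C1_on U g -> C1_on U (fun y => f y + g y).
Proof.
move=> oU Cf Cg y Uy; have [cf df] := Cf y Uy; have [cg dg] := Cg y Uy.
split; first exact: (cvgD cf cg).
move=> l; have [dfl cfl] := df l; have [dgl cgl] := dg l.
split; first exact: derivableD.
apply: (@near_eq_continuous _ _
  (fun z => 'D_(ebasis l) f z + 'D_(ebasis l) g z)); last first.
  exact: (cvgD cfl cgl).
apply: near_open oU Uy _ => z Uz.
have [_ dfz] := Cf z Uz; have [_ dgz] := Cg z Uz.
have [dfzl _] := dfz l; have [dgzl _] := dgz l.
by rewrite (deriveD dfzl dgzl).
Qed.

Lemma C1_on_cst n (U : set 'rV[R]_n) (k : R) : C1_on U (fun=> k).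
Proof.
move=> y Uy; split; first exact: (@cst_continuous _ _ k y).
move=> l; split; first exact: derivable_cst.
rewrite (_ : 'D__ _ = fun=> 0); first exact: (@cst_continuous _ _ (0 : R) y).
by apply/funext => z; rewrite derive_cst.
Qed.

Lemma C1_on_sum n (U : set 'rV[R]_n) (I : Type) (r : seq I)
    (f : I -> 'rV[R]_n -> R) : open U ->
  (forall i, C1_on U (f i)) -> C1_on U (fun y => \sum_(i <- r) f i y).
Proof.
move=> oU Cf; elim: r => [|i r IHr].
  by apply: eq_C1_on oU _ (@C1_on_cst _ U 0) => y _; rewrite big_nil.
by apply: eq_C1_on oU _ (C1_onD oU (Cf i) IHr) => y _; rewrite big_cons.
Qed.

Lemma Ck1_C1_on n (U : set 'rV[R]_n) (f : 'rV[R]_n -> R) : Ck 1 U f -> C1_on U f.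
Proof.
move=> [df cf] y Uy; split; first exact/differentiable_continuous/df.
by move=> l; split; [exact/diff_derivable/df|exact: cf].
Qed.

Lemma derive_coord n p q (F : 'rV[R]_n -> 'M[R]_(p, q)) y v a b :
  derivable F y v -> is_derive y v (fun z => F z a b) ('D_v F y a b).
Proof.
move=> dF; have dFab : derivable (fun z => F z a b) y v.
  exact: (derivable_mxP _ _ _).1.
by split=> //; rewrite (derive_mx dF) mxE.
Qed.

Lemma Ck1_coord n p q (U : set 'rV[R]_n) (F : 'rV[R]_n -> 'M[R]_(p, q)) a b :
  open U -> Ck 1 U F -> Ck 1 U (fun z => F z a b).
Proof.
move=> oU [dF cF]; split.
  move=> y Uy; apply: (@differentiable_comp _ _ _ _ F
    (fun M : 'M[R]_(p, q) => M a b)).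
    exact: dF.
  exact: differentiable_coord.
move=> l y Uy; apply: (@near_eq_continuous _ _ (fun z => 'D_(ebasis l) F z a b)).
  apply: near_open oU Uy _ => z Uz.
  by have [_ ->] := derive_coord a b
    (@diff_derivable _ _ _ F z (ebasis l) (dF z Uz)).
apply: (@continuous_comp _ _ _ ('D_(ebasis l) F) (fun M : 'M[R]_(p, q) => M a b)).
  exact: cF.
exact: coord_continuous.
Qed.

Lemma derive_row n (W : normedModType R) (f : 'rV[R]_n -> W) y (v : 'rV[R]_n) :
  differentiable f y -> 'D_v f y = \sum_a v 0 a *: 'D_(ebasis a) f y.
Proof.
move=> df; rewrite deriveE// {1}(row_sum_delta v) linear_sum.
by apply: eq_bigr => a _; rewrite linearZ/= deriveE.
Qed.

Lemma derive_comp_row n m (W : normedModType R) (f : 'rV[R]_m -> W)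
    (u : 'rV[R]_n -> 'rV[R]_m) y v :
  differentiable f (u y) -> differentiable u y ->
  'D_v (f \o u) y = \sum_a 'D_v u y 0 a *: 'D_(ebasis a) f (u y).
Proof.
move=> df du; rewrite deriveE; last exact: differentiable_comp.
by rewrite diff_comp//= -derive_row// !deriveE.
Qed.

Lemma continuous_at_sum (T : topologicalType) (I : Type) (r : seq I)
    (f : I -> T -> R) (y : T) : (forall i, {for y, continuous (f i)}) ->
  {for y, continuous (fun z => \sum_(i <- r) f i z)}.
Proof.
move=> cf; elim: r => [|i r IHr].
  rewrite (_ : (fun _ => _) = (fun=> 0));
    first exact: (@cst_continuous _ _ (0 : R) y).
  by apply/funext => z; rewrite big_nil.
rewrite (_ : (fun _ => _) = (fun z => f i z + \sum_(j <- r) f j z)).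
  exact: (cvgD (cf i) IHr).
by apply/funext => z; rewrite big_cons.
Qed.

Lemma C1_on_comp n m (U : set 'rV[R]_n) (O : set 'rV[R]_m) (f : 'rV[R]_m -> R)
    (u : 'rV[R]_n -> 'rV[R]_m) : open U -> Ck 1 O f -> Ck 1 U u ->
  (forall y, U y -> O (u y)) -> C1_on U (f \o u).
Proof.
move=> oU [df cf] [du cu] UO.
move=> y Uy; have dfu z : U z -> differentiable (f \o u) z.
  by move=> Uz; apply: differentiable_comp; [exact: du|exact/df/UO].
split; first exact/differentiable_continuous/dfu.
move=> l; split; first exact/diff_derivable/dfu.
apply: (@near_eq_continuous _ _ (fun z => \sum_a 'D_(ebasis l) u z 0 a *
    ('D_(ebasis a) f \o u) z)).
  apply: near_open oU Uy _ => z Uz;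
    by rewrite (@derive_comp_row _ _ _ f u z (ebasis l) (df _ (UO _ Uz)) (du _ Uz)).
apply: continuous_at_sum => a.
have c1 : {for y, continuous (fun z => 'D_(ebasis l) u z 0 a)}.
  apply: (@continuous_comp _ _ _ ('D_(ebasis l) u) (fun M : 'rV[R]_m => M 0 a)).
    exact: cu.
  exact: coord_continuous.
have c2 : {for y, continuous (fun z => 'D_(ebasis a) f (u z))}.
  apply: (@continuous_comp _ _ _ u ('D_(ebasis a) f)).
    exact/differentiable_continuous/du.
  exact/cf/UO.
exact: (cvgM c1 c2).
Qed.

End Calculus.

(** * Contraction of the Christoffel symbols *)

Section Algebra.
Context {R : realType} {m : nat}.
Variables (G : 'M[R]_m) (dG : 'I_m -> 'I_m -> 'I_m -> R).
Hypothesis symG : forall a b, G a b = G b a.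
Hypothesis symdG : forall c a b, dG c a b = dG c b a.
Hypothesis unitG : G \in unitmx.

Let Gam a b c := 2^-1 * \sum_l invmx G a l * (dG b l c + dG c l b - dG l b c).

(** Lowering the upper index of the symbol gives the Christoffel symbols of the
    first kind. *)
Let lower d b c :
  \sum_a G d a * Gam a b c = 2^-1 * (dG b d c + dG c d b - dG d b c).
Proof.
under eq_bigr do rewrite /Gam mulrCA mulr_sumr.
rewrite -mulr_sumr exchange_big/=; congr (_ * _).
under eq_bigr => l _.
  under eq_bigr do rewrite mulrA.
  rewrite -mulr_suml.
  have -> : \sum_i G d i * invmx G i l = (d == l)%:R.
    by have := congr1 (fun M : 'M[R]_m => M d l) (mulmxV unitG); rewrite !mxE.
  over.
rewrite (bigD1 d)//= eqxx mul1r big1 ?addr0// => l ld.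
by rewrite eq_sym (negPf ld) mul0r.
Qed.

Let swap2 (F : 'I_m -> 'I_m -> R) : \sum_a \sum_b F a b = \sum_a \sum_b F b a.
Proof. exact: exchange_big. Qed.

(** Here [p], [q] are the components of [d_j phi] and [d_k phi], [w] and [s]
    those of [d_j d_j phi] and [d_j d_k phi].  The left side is
    [d_j T_jk - d_k T_jj / 2] for a fixed [j], expanded by the product and chain
    rules; on the right is the scalar product of [d_k phi] with the [j]-th term
    of the tension field.  The terms in [s] cancel by symmetry of [G]; the
    derivatives of the metric on the left are the Christoffel symbols of the
    first kind contracted with [p], [p] and [q]. *)
Lemma christoffel_contract (p q w s : 'I_m -> R) :
  \sum_a \sum_b (w a * G a b * q b + p a * (\sum_c dG c a b * p c) * q b +
                 p a * G a b * s b) -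
  2^-1 * (\sum_a \sum_b (s a * G a b * p b +
            p a * (\sum_c dG c a b * q c) * p b + p a * G a b * s b)) =
  \sum_d q d * \sum_a G d a * (w a + \sum_b \sum_c Gam a b c * p b * p c).
Proof.
pose L1 := \sum_a \sum_b w a * G a b * q b.
pose L2 := \sum_a \sum_b p a * (\sum_c dG c a b * p c) * q b.
pose L3 := \sum_a \sum_b p a * G a b * s b.
pose L4 := \sum_a \sum_b p a * (\sum_c dG c a b * q c) * p b.
have sum3 (F1 F2 F3 : 'I_m -> 'I_m -> R) :
    \sum_a \sum_b (F1 a b + F2 a b + F3 a b) =
    \sum_a \sum_b F1 a b + \sum_a \sum_b F2 a b + \sum_a \sum_b F3 a b.
  by rewrite -!big_split/=; apply: eq_bigr => a _; rewrite -!big_split.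
have -> : \sum_d q d *
    (\sum_a G d a * (w a + \sum_b \sum_c Gam a b c * p b * p c)) =
    L1 + (L2 - 2^-1 * L4).
  transitivity (\sum_d q d * (\sum_a G d a * w a +
    (\sum_b \sum_c dG b d c * p b * p c -
     2^-1 * \sum_b \sum_c dG d b c * p b * p c))).
    apply: eq_bigr => d _; congr (_ * _).
    under eq_bigr do rewrite mulrDr.
    rewrite big_split/=; congr (_ + _).
    transitivity (\sum_b \sum_c (\sum_a G d a * Gam a b c) * (p b * p c)).
      under eq_bigr do rewrite mulr_sumr.
      rewrite exchange_big/=; apply: eq_bigr => b _.
      under eq_bigr do rewrite mulr_sumr.
      rewrite exchange_big/=; apply: eq_bigr => c _.
      by rewrite mulr_suml; apply: eq_bigr => a _; ring.
    transitivity (2^-1 * (\sum_b \sum_c dG b d c * p b * p c) +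
      2^-1 * (\sum_b \sum_c dG c d b * p b * p c) -
      2^-1 * (\sum_b \sum_c dG d b c * p b * p c)).
      rewrite !mulr_sumr -sumrN -!big_split/=; apply: eq_bigr => b _.
      rewrite !mulr_sumr -sumrN -!big_split/=; apply: eq_bigr => c _.
      by rewrite lower; ring.
    congr (_ - _).
    have -> : \sum_b \sum_c dG c d b * p b * p c = \sum_b \sum_c dG b d c * p b * p c.
      rewrite swap2; apply: eq_bigr => b _; apply: eq_bigr => c _; ring.
    by rewrite -mulrDl -[RHS]mul1r; congr (_ * _); lra.
  under eq_bigr do rewrite mulrDr mulrBr.
  rewrite big_split/=; congr (_ + _).
    rewrite /L1 swap2; apply: eq_bigr => d _; rewrite mulr_sumr.
    by apply: eq_bigr => a _; rewrite symG; ring.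
  rewrite sumrB; congr (_ - _).
    rewrite /L2 swap2; apply: eq_bigr => d _.
    rewrite swap2 mulr_sumr; apply: eq_bigr => a _.
    rewrite mulr_sumr mulr_suml !mulr_sumr; apply: eq_bigr => c _.
    by rewrite (symdG _ a d); ring.
  under eq_bigr do rewrite mulrCA mulr_sumr.
  rewrite -mulr_sumr; congr (_ * _).
  rewrite exchange_big/=; apply: eq_bigr => b _.
  under eq_bigr do rewrite mulr_sumr.
  rewrite exchange_big/=; apply: eq_bigr => c _.
  by rewrite mulr_sumr mulr_suml; apply: eq_bigr => d _; ring.
rewrite !sum3 -/L1 -/L2 -/L3 -/L4.
have -> : \sum_a \sum_b s a * G a b * p b = L3.
  rewrite swap2; apply: eq_bigr => a _; apply: eq_bigr => b _.
  by rewrite symG; ring.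
by field.
Qed.

End Algebra.

(** * The stress-energy tensor in charts *)

Section Charts.
Context {R : realType} {m n : nat} {N : smoothManifold R m}.
Variable g : riemannianMetric N.

(** A positive definite matrix has trivial kernel. *)
Lemma gmx_unit i z : chart_img i z -> gmx g i z \in unitmx.
Proof.
move=> iz; rewrite -row_free_unit; apply: inj_row_free => v vg.
apply/eqP; apply: contraT => v0; have := gmx_pos g iz v0.
by rewrite vg mul0mx mxE ltxx.
Qed.

Lemma dgmx_sym i z c a b : chart_img i z -> dgmx g i z c a b = dgmx g i z c b a.
Proof.
move=> iz; have [dg _] := gmx_smooth g i 1.
have dgz v : derivable (gmx g i) z v by exact/diff_derivable/dg.
rewrite /dgmx.
have [_ <-] := derive_coord a b (dgz (ebasis c)).
have [_ <-] := derive_coord b a (dgz (ebasis c)).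
have nE : \forall t \near z, gmx g i t a b = gmx g i t b a.
  apply: (@near_open _ (chart_img i)) => // [|t it]; first exact: chart_img_open.
  by rewrite -{1}(gmx_sym g it) mxE.
exact: near_eq_derive nE.
Qed.

Variable phi : 'rV[R]_n -> N.
Hypothesis sphi : smooth_map phi.

Definition pull_metric (j k : 'I_n) (y : 'rV[R]_n) : R :=
  let c := chart_at (phi y) in
  (dmap phi c y (ebasis j) *m gmx g c (chart c (phi y)) *m
    (dmap phi c y (ebasis k))^T) 0 0.

Lemma mulmx_rV3E (v w : 'rV[R]_m) (M : 'M[R]_m) :
  (v *m M *m w^T) 0 0 = \sum_a \sum_b v 0 a * M a b * w 0 b.
Proof.
rewrite mxE exchange_big/=; apply: eq_bigr => b _.
by rewrite !mxE mulr_suml.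
Qed.

Lemma sqnorm_dmapE y X :
  sqnorm_dmap g phi y X = \sum_j \sum_k X 0 j * X 0 k * pull_metric j k y.
Proof.
rewrite /sqnorm_dmap /sqnorm /pull_metric; set c := chart_at _.
have [_ /(_ c 1%N)[du _]] := sphi.
have duy : differentiable (chart c \o phi) y by apply: du; exact: chart_atP.
have -> : dmap phi c y X = \sum_j X 0 j *: dmap phi c y (ebasis j).
  exact: derive_row.
rewrite mulmx_suml linear_sum/= mulmx_suml summxE; apply: eq_bigr => j _.
rewrite mulmx_sumr summxE; apply: eq_bigr => k _.
by rewrite linearZ/= -!scalemxAl -!scalemxAr !mxE mulrA.
Qed.

Section Local.
Variable i : chart_index N.
Let U : set 'rV[R]_n := phi @^-1` chart_dom i.
Let u : 'rV[R]_n -> 'rV[R]_m := chart i \o phi.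
Let P (j : 'I_n) (a : 'I_m) (y : 'rV[R]_n) : R := 'D_(ebasis j) u y 0 a.
Let G (a b : 'I_m) (y : 'rV[R]_n) : R := gmx g i (u y) a b.

Lemma open_chart_preimage : open U.
Proof.
by have [/continuousP cphi _] := sphi; apply: cphi; exact: chart_dom_open.
Qed.
Let oU := open_chart_preimage.

Let Uimg y : U y -> chart_img i (u y).
Proof. by move=> Uy; exists (phi y). Qed.

Let Cu : Ck 1 U u.
Proof. by have [_ /(_ i 1%N)] := sphi. Qed.

Let CDu j : Ck 1 U ('D_(ebasis j) u).
Proof. by have [_ /(_ i 2%N)[_ /(_ j)]] := sphi. Qed.

Let Cg a b : Ck 1 (chart_img i) (fun z => gmx g i z a b).
Proof.
by apply: Ck1_coord; [exact: chart_img_open|exact: gmx_smooth].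
Qed.

Let CP j a : C1_on U (P j a).
Proof. exact: (Ck1_C1_on (Ck1_coord 0 a oU (CDu j))). Qed.

Let CG a b : C1_on U (G a b).
Proof. exact: (C1_on_comp oU (Cg a b) Cu Uimg). Qed.

(** The chart chosen by [chart_at] varies with [y], which makes the definition
    of [pull_metric] useless for derivatives; by the transformation rule of the
    metric, one fixed chart computes it on a whole open set. *)
Lemma pull_metric_chart j k y : U y ->
  pull_metric j k y = \sum_a \sum_b P j a y * G a b y * P k b y.
Proof.
move=> Uy; rewrite /pull_metric; set c := chart_at (phi y).
have cy : chart_dom c (phi y) by exact: chart_atP.
have [du _] := Cu.
have dJ l : dmap phi c y (ebasis l) =
    'D_(ebasis l) u y *m transition_jacobian i c (u y).
  have -> : dmap phi c y (ebasis l) =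
      'D_(ebasis l) ((chart c \o chart_inv i) \o u) y.
    apply: near_eq_derive; apply: near_open oU Uy _ => z Uz /=.
    by rewrite /u /= chartK.
  have [dt _] := chart_compatible i c 1.
  rewrite derive_comp_row; [|apply: dt; by exists (phi y)|exact: du].
  apply/rowP => b; rewrite summxE mxE; apply: eq_bigr => a _.
  by rewrite !mxE.
have E : gmx g i (u y) = transition_jacobian i c (u y) *m
    gmx g c (chart c (phi y)) *m (transition_jacobian i c (u y))^T.
  exact: gmx_tensor.
rewrite !dJ trmx_mul.
transitivity (('D_(ebasis j) u y *m gmx g i (u y) *m ('D_(ebasis k) u y)^T) 0 0).
  by rewrite E !mulmxA.
exact: mulmx_rV3E.
Qed.

Lemma pull_metric_C1 j k : C1_on U (pull_metric j k).
Proof.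
apply: (eq_C1_on oU (fun y Uy => esym (pull_metric_chart j k Uy))).
apply: C1_on_sum => // a; apply: C1_on_sum => // b.
by apply: C1_onM => //; apply: C1_onM.
Qed.

Let DP y l j a : R := 'D_(ebasis l) ('D_(ebasis j) u) y 0 a.
Let dG y c a b : R := dgmx g i (u y) c a b.

Let is_deriveP y l j a : U y -> is_derive y (ebasis l) (P j a) (DP y l j a).
Proof.
move=> Uy; have [dDu _] := CDu j.
by apply: derive_coord; exact/diff_derivable/dDu.
Qed.

Let is_deriveG y l a b : U y ->
  is_derive y (ebasis l) (G a b) (\sum_c dG y c a b * P l c y).
Proof.
move=> Uy; have [_ /(_ l)[dGl _]] := CG a b Uy; split=> //.
have [du _] := Cu; have [dg _] := Cg a b; have [dgm _] := gmx_smooth g i 1.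
rewrite (@derive_comp_row _ _ _ _ (fun z => gmx g i z a b) u); last 2 first.
- exact/dg/Uimg.
- exact: du.
apply: eq_bigr => c _; rewrite mulrC; congr (_ * _).
have dgc : derivable (gmx g i) (u y) (ebasis c) by exact/diff_derivable/dgm/Uimg.
by have [_ ->] := derive_coord a b dgc.
Qed.

Let is_derive_pull y l j k : U y ->
  'D_(ebasis l) (pull_metric j k) y =
  \sum_a \sum_b (DP y l j a * G a b y * P k b y +
    P j a y * (\sum_c dG y c a b * P l c y) * P k b y +
    P j a y * G a b y * DP y l k b).
Proof.
move=> Uy.
transitivity ('D_(ebasis l) (\sum_a \sum_b (P j a * G a b * P k b)) y).
  apply: near_eq_derive; apply: near_open oU Uy _ => z Uz.
  rewrite pull_metric_chart// fct_sumE; apply: eq_bigr => a _.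
  by rewrite fct_sumE.
apply: derive_val; apply: is_derive_sum => a; apply: is_derive_sum => b.
have d1 := is_deriveM (is_deriveP l j a Uy) (is_deriveG l a b Uy).
apply: (is_derive_eq (is_deriveM d1 (is_deriveP l k b Uy))).
by rewrite /GRing.scale/= !fctE; ring.
Qed.

(** [mixed_derivatives] for the coordinate [a] of the map; its derivatives
    agree with [P] on the open set [U] only, hence the passages through
    neighbourhoods. *)
Let schwarz y l j a : U y -> DP y l j a = DP y j l a.
Proof.
move=> Uy; pose f z := u z 0 a.
have [du _] := Cu.
have Df v z : U z -> is_derive z v f ('D_v u z 0 a).
  by move=> Uz; apply: derive_coord; exact/diff_derivable/du.
have nP w z : U z -> \forall t \near z, P w a t = 'D_(ebasis w) f t.
  move=> Uz; apply: near_open oU Uz _ => t Ut.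
  by have [_ ->] := Df (ebasis w) t Ut.
have DPf w v z : U z -> 'D_(ebasis w) ('D_(ebasis v) f) z = DP z w v a.
  move=> Uz; rewrite -(near_eq_derive _ (nP v z Uz)).
  by have [_ ->] := is_deriveP w v a Uz.
have cDP w v : {for y, continuous ('D_(ebasis w) ('D_(ebasis v) f))}.
  have [_ /(_ w)[_]] := CP v a Uy.
  apply: near_eq_continuous; apply: near_open oU Uy _ => z Uz.
  by rewrite DPf//; have [_ ->] := is_deriveP w v a Uz.
apply: etrans (esym (DPf l j y Uy)) (etrans _ (DPf j l y Uy)).
apply: mixed_derivatives; [|exact: cDP|exact: cDP].
apply: near_open oU Uy _ => z Uz; split.
- by have [] := Df (ebasis j) z Uz.
- by have [] := Df (ebasis l) z Uz.
- by apply: (near_eq_derivable (nP j z Uz)); have [] := is_deriveP l j a Uz.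
- by apply: (near_eq_derivable (nP l z Uz)); have [] := is_deriveP j l a Uz.
Qed.

Variable V : N -> R.
Hypothesis sV : smooth_function V.

Let CV : Ck 1 (chart_img i) (V \o chart_inv i).
Proof. exact: sV. Qed.

Let V_chart y : U y -> ((V \o chart_inv i) \o u) y = (V \o phi) y.
Proof. by move=> Uy; rewrite /= chartK. Qed.

Lemma potential_C1 : C1_on U (V \o phi).
Proof. exact: (eq_C1_on oU V_chart (C1_on_comp oU CV Cu Uimg)). Qed.

Let derive_potential y l : U y -> 'D_(ebasis l) (V \o phi) y =
  \sum_a P l a y * 'D_(ebasis a) (V \o chart_inv i) (u y).
Proof.
move=> Uy; rewrite -(near_eq_derive _ (near_open oU Uy V_chart)).
have [du _] := Cu; have [dv _] := CV.
by rewrite derive_comp_row; [|exact/dv/Uimg|exact: du].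
Qed.

Hypothesis hphi : forall y, U y -> tension_field g phi i y = - grad g i V (phi y).

(** The sum over [j] of [christoffel_contract] produces the tension field,
    which is minus the gradient of the potential; lowering the index of the
    gradient gives back the derivative of [V]. *)
Lemma conservation_chart y k : U y ->
  \sum_j 'D_(ebasis j) (pull_metric j k) y =
  2^-1 * \sum_j 'D_(ebasis k) (pull_metric j j) y - 'D_(ebasis k) (V \o phi) y.
Proof.
move=> Uy; have iu := Uimg Uy.
pose p j a := P j a y; pose M := gmx g i (u y).
pose v a := 'D_(ebasis a) (V \o chart_inv i) (u y).
pose X j a := DP y j j a +
  \sum_b \sum_c christoffel g i (u y) a b c * p j b * p j c.
have symM a b : M a b = M b a.
  by have := congr1 (fun t : 'M[R]_m => t b a) (gmx_sym g iu); rewrite mxE.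
have key j : 'D_(ebasis j) (pull_metric j k) y -
    2^-1 * 'D_(ebasis k) (pull_metric j j) y =
    \sum_d p k d * \sum_a M d a * X j a.
  have C := christoffel_contract symM (fun c a b => dgmx_sym c a b iu)
    (gmx_unit iu) (p j) (p k) (DP y j j) (DP y j k).
  apply: etrans C; congr (_ - _ * _); first exact: is_derive_pull.
  apply: etrans (is_derive_pull k j j Uy) _.
  apply: eq_bigr => a _; apply: eq_bigr => b _.
  have sa := schwarz k j a Uy; have sb := schwarz k j b Uy.
  have subst2 (x x' t t' c1 c2 c3 z : R) : x = x' -> t = t' ->
      x * c1 * c2 + z + c3 * t = x' * c1 * c2 + z + c3 * t' by move=> -> ->.
  exact: subst2 sa sb.
have tension a : \sum_j X j a = - \sum_b invmx M a b * v b.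
  have := congr1 (fun t : 'rV[R]_m => t 0 a) (hphi Uy).
  rewrite /tension_field summxE !mxE => <-.
  by apply: eq_bigr => j _; rewrite mxE.
have lower d : \sum_a M d a * (\sum_b invmx M a b * v b) = v d.
  transitivity (\sum_b (M *m invmx M) d b * v b).
    under eq_bigr do rewrite mulr_sumr.
    rewrite exchange_big/=; apply: eq_bigr => b _; rewrite mxE mulr_suml.
    by apply: eq_bigr => a _; rewrite mulrA.
  rewrite mulmxV ?gmx_unit// (bigD1 d)//= big1 ?addr0 => [|b bd].
    by rewrite mxE eqxx mul1r.
  by rewrite mxE eq_sym (negPf bd) mul0r.
have subE (A B C : R) : A - B = C -> A = B + C by move=> <-; rewrite addrC subrK.
have S1 : \sum_j \sum_d p k d * \sum_a M d a * X j a =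
    - 'D_(ebasis k) (V \o phi) y.
  rewrite exchange_big/=.
  transitivity (\sum_d - (p k d * v d)); last first.
    by rewrite sumrN; exact: congr1 (esym (derive_potential k Uy)).
  apply: eq_bigr => d _; rewrite -mulr_sumr -mulrN.
  apply: (congr1 (fun t => p k d * t)).
  rewrite exchange_big/= -(lower d) -sumrN; apply: eq_bigr => a _.
  by rewrite -mulr_sumr tension mulrN.
apply: etrans (eq_bigr _ (fun j _ => subE _ _ _ (key j))) _.
rewrite big_split/= -mulr_sumr; exact: (congr1 (fun t => _ + t) S1).
Qed.

End Local.
End Charts.

(** * The monotonicity formula *)

Theorem theorem2p14 (R : realType) (m n : nat)
    (N : smoothManifold R m) (g : riemannianMetric N)
    (V : N -> R) (hV : smooth_function V)
    (phi : 'rV[R]_n.+1 -> N) (hphi : harmonic_map_with_potential g phi V)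
    (x : 'rV[R]_n.+1) (r : R) (hr : 0 < r) :
  is_derive r 1
    (fun s : R => s ^ (2%:Z - n.+1%:Z) *
       \int[lebesgue_rV n.+1]_(y in eball x s)
         (2^-1 * energy_density g phi y - V (phi y)))
    (r ^ (2%:Z - n.+1%:Z) *
       sphere_integral x r (fun y => sqnorm_dmap g phi y (radial x y))
     - 2 * r ^ (1 - n.+1%:Z) *
       \int[lebesgue_rV n.+1]_(y in eball x r) V (phi y)).
Proof.
have [sphi tau] := hphi.
have at_chart y : (phi @^-1` chart_dom (chart_at (phi y))) y by exact: chart_atP.
have CT j k y := pull_metric_C1 g sphi j k (at_chart y).
have CW y := potential_C1 sphi hV (at_chart y).
have cons k y := conservation_chart sphi hV (fun z hz => tau _ z hz) k (at_chart y).
have := @pohozaev R n (pull_metric g phi) (V \o phi)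
  (fun j k y => (CT j k y).1) (fun y => (CW y).1)
  (fun j k l y => ((CT j k y).2 l).1) (fun l y => ((CW y).2 l).1)
  (fun j k l y => ((CT j k y).2 l).2) (fun l y => ((CW y).2 l).2) cons x r hr.
have -> : (fun y => sqnorm_dmap g phi y (radial x y)) = (fun y => \sum_j \sum_k
    radial x y 0 j * radial x y 0 k * pull_metric g phi j k y).
  by apply/funext => y; exact: sqnorm_dmapE.
exact.
Qed.
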